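(* Let $\mathsf{C}$ be a strict braided monoidal category and let $(H,m_H)$ be a cocommutative post-Hopf algebra in $\mathsf{C}$. Let $\beta_H$ be the convolution inverse of $\alpha_H$, and let $\widetilde{\beta}_H=(b_H\otimes H)\circ(H\otimes\beta_H):H\otimes H\to H$. Suppose that $$\delta_H\circ\widetilde{\beta}_H=(\widetilde{\beta}_H\otimes\widetilde{\beta}_H)\circ(H\otimes c_{H,H}\otimes H)\circ(\delta_H\otimes\delta_H).$$ Then $\widehat{\mathbb{H}}=(H,\widehat{H})$ is a cocommutative Hopf brace in $\mathsf{C}$, where $\widehat{H}=(H,\eta_H,\widehat{\mu}_H,\varepsilon_H,\delta_H,\widehat{\lambda}_H)$ with $\widehat{\mu}_H=\mu_H\circ(H\otimes m_H)\circ(\delta_H\otimes H)$ and $\widehat{\lambda}_H=(b_H\otimes H)\circ(H\otimes\beta_H)\circ c_{H,H}\circ(H\otimes\lambda_H)\circ\delta_H$.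
   Context: $\mathsf{C}$ is a strict braided monoidal category with tensor product $\otimes$, unit object $K$ and braiding $c$ (not assumed symmetric). For an object $P$ and a morphism $f$, $P\otimes f$ means $id_P\otimes f$ and $f\otimes P$ means $f\otimes id_P$. Algebras, coalgebras, bialgebras and Hopf algebras are internal to $\mathsf{C}$; the tensor product of coalgebras $D,E$ has coproduct $(D\otimes c_{D,E}\otimes E)\circ(\delta_D\otimes\delta_E)$ and counit $\varepsilon_D\otimes\varepsilon_E$, and the tensor product of algebras $A,B$ has product $(\mu_A\otimes\mu_B)\circ(A\otimes c_{B,A}\otimes B)$. A Hopf algebra $H=(H,\eta_H,\mu_H,\varepsilon_H,\delta_H,\lambda_H)$ is a bialgebra with a morphism (antipode) $\lambda_H$ such that $\mu_H\circ(H\otimes\lambda_H)\circ\delta_H=\eta_H\circ\varepsilon_H=\mu_H\circ(\lambda_H\otimes H)\circ\delta_H$; it is cocommutative if $c_{H,H}\circ\delta_H=\delta_H$. An object $P$ is finite if there is an object $P^*$ (its dual) and a $\mathsf{C}$-adjunction $P\otimes-\dashv P^*\otimes-$; the unit and counit evaluated at $K$ are morphisms $a_P:K\to P^*\otimes P$ and $b_P:P\otimes P^*\to K$ with $(b_P\otimes P)\circ(P\otimes a_P)=id_P$ and $(P^*\otimes b_P)\circ(a_P\otimes P^* )=id_{P^*}$. Post-Hopf algebra: a pair $(H,m_H)$ with $H$ a finite Hopf algebra in $\mathsf{C}$ and $m_H:H\otimes H\to H$ a morphism such that (i) $m_H$ is a coalgebra morphism; (ii) $m_H\circ(H\otimes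 m_H)=m_H\circ((\mu_H\circ(H\otimes m_H)\circ(\delta_H\otimes H))\otimes H)$; (iii) $m_H\circ(H\otimes\mu_H)=\mu_H\circ(m_H\otimes m_H)\circ(H\otimes c_{H,H}\otimes H)\circ(\delta_H\otimes H\otimes H)$; (iv) $\alpha_H=(H^*\otimes m_H)\circ(c_{H,H^*}\otimes H)\circ(H\otimes a_H):H\to H^*\otimes H$ is convolution invertible, i.e. there is $\beta_H:H\to H^*\otimes H$ with $(H^*\otimes b_H\otimes H)\circ(\alpha_H\otimes\beta_H)\circ\delta_H=\varepsilon_H\otimes a_H=(H^*\otimes b_H\otimes H)\circ(\beta_H\otimes\alpha_H)\circ\delta_H$. It is cocommutative if $H$ is cocommutative. Hopf brace: a coalgebra $(H,\varepsilon_H,\delta_H)$ with two Hopf algebra structures $H_1=(H,\eta_H^1,\mu_H^1,\varepsilon_H,\delta_H,\lambda_H^1)$ and $H_2=(H,\eta_H^2,\mu_H^2,\varepsilon_H,\delta_H,\lambda_H^2)$ in $\mathsf{C}$ such that $\mu_H^2\circ(H\otimes\mu_H^1)=\mu_H^1\circ(\mu_H^2\otimes\Gamma_{H_1})\circ(H\otimes c_{H,H}\otimes H)\circ(\delta_H\otimes H\otimes H)$, where $\Gamma_{H_1}=\mu_H^1\circ(\lambda_H^1\otimes\mu_H^2)\circ(\delta_H\otimes H)$. It is denoted $(H_1,H_2)$, and is cocommutative if $c_{H,H}\circ\delta_H=\delta_H$. *)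

(* Defs.v *)
From Stdlib Require Import ProofIrrelevance.
From mathcomp Require Import ssreflect ssrfun ssrbool.

Set Implicit Arguments.
Unset Strict Implicit.
Unset Printing Implicit Defensive.

Declare Scope cat_scope.
Delimit Scope cat_scope with cat.
Local Open Scope cat_scope.

Record category := Category {
  Ob :> Type;
  Hom : Ob -> Ob -> Type;
  idm : forall X, Hom X X;
  comp : forall X Y Z, Hom Y Z -> Hom X Y -> Hom X Z;
  comp_idl : forall X Y (f : Hom X Y), comp (idm Y) f = f;
  comp_idr : forall X Y (f : Hom X Y), comp f (idm X) = f;
  comp_assoc : forall X Y Z W (h : Hom Z W) (g : Hom Y Z) (f : Hom X Y),
    comp h (comp g f) = comp (comp h g) f }.

Arguments Hom {c} X Y.
Arguments idm {c} X.
Arguments comp {c X Y Z} g f.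

Notation "g ∘ f" := (comp g f)
  (at level 40, left associativity, format "g  ∘  f") : cat_scope.

(* In a strict monoidal category X ⊗ (Y ⊗ Z) and (X ⊗ Y) ⊗ Z are equal, but
   not convertible. [idc e] is the identity morphism of X = Y, with its
   codomain written Y; inserting it only adjusts the type of a morphism. *)
Definition idc (C : category) (X Y : C) (e : X = Y) : Hom X Y :=
  match e in _ = Z return Hom X Z with eq_refl => idm X end.

Record strictMonCat := StrictMonCat {
  scat :> category;
  tens : scat -> scat -> scat;
  unitO : scat;
  tensm : forall X X' Y Y' : scat,
    Hom X X' -> Hom Y Y' -> Hom (tens X Y) (tens X' Y');
  tensm_id : forall X Y : scat, tensm (idm X) (idm Y) = idm (tens X Y);
  tensm_comp : forall (X X' X'' Y Y' Y'' : scat) (f' : Hom X' X'')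
      (f : Hom X X') (g' : Hom Y' Y'') (g : Hom Y Y'),
    tensm (f' ∘ f) (g' ∘ g) = tensm f' g' ∘ tensm f g;
  tensA : forall X Y Z : scat, tens (tens X Y) Z = tens X (tens Y Z);
  tens1X : forall X : scat, tens unitO X = X;
  tensX1 : forall X : scat, tens X unitO = X;
  tensmA : forall (X X' Y Y' Z Z' : scat) (f : Hom X X') (g : Hom Y Y')
      (h : Hom Z Z'),
    idc (tensA X' Y' Z') ∘ tensm (tensm f g) h
    = tensm f (tensm g h) ∘ idc (tensA X Y Z);
  tensm1f : forall (X Y : scat) (f : Hom X Y),
    idc (tens1X Y) ∘ tensm (idm unitO) f = f ∘ idc (tens1X X);
  tensmf1 : forall (X Y : scat) (f : Hom X Y),
    idc (tensX1 Y) ∘ tensm f (idm unitO) = f ∘ idc (tensX1 X) }.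

Arguments tens {s} X Y.
Arguments unitO {s}.
Arguments tensm {s X X' Y Y'} f g.
Arguments tensA {s} X Y Z.
Arguments tens1X {s} X.
Arguments tensX1 {s} X.

(* Objects: X ⊗ Y.  Morphisms: f ⊠ g is usually written f ⊗ g, and
   P ◁ f = P ⊗ f, f ▷ P = f ⊗ P are the whiskerings by an object. *)
Notation "X ⊗ Y" := (tens X Y) (at level 35, right associativity) : cat_scope.
Notation "f ⊠ g" := (tensm f g) (at level 35, no associativity) : cat_scope.
Notation "P ◁ f" := (tensm (idm P) f)
  (at level 35, right associativity) : cat_scope.
Notation "f ▷ P" := (tensm f (idm P)) (at level 34, left associativity)
  : cat_scope.

Section StructuralIdentities.
Variable C : strictMonCat.
Implicit Types X Y Z W : C.

Definition assoc X Y Z : Hom ((X ⊗ Y) ⊗ Z) (X ⊗ (Y ⊗ Z)) := idc (tensA X Y Z).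
Definition assocV X Y Z : Hom (X ⊗ (Y ⊗ Z)) ((X ⊗ Y) ⊗ Z) :=
  idc (esym (tensA X Y Z)).
Definition lunit X : Hom (unitO ⊗ X) X := idc (tens1X X).
Definition lunitV X : Hom X (unitO ⊗ X) := idc (esym (tens1X X)).
Definition runit X : Hom (X ⊗ unitO) X := idc (tensX1 X).
Definition runitV X : Hom X (X ⊗ unitO) := idc (esym (tensX1 X)).

Lemma tensAA X Y Z W : (X ⊗ Y) ⊗ (Z ⊗ W) = (X ⊗ (Y ⊗ Z)) ⊗ W.
Proof. by rewrite !tensA. Qed.

Definition assoc4 X Y Z W : Hom ((X ⊗ Y) ⊗ (Z ⊗ W)) ((X ⊗ (Y ⊗ Z)) ⊗ W) :=
  idc (tensAA X Y Z W).
Definition assoc4V X Y Z W : Hom ((X ⊗ (Y ⊗ Z)) ⊗ W) ((X ⊗ Y) ⊗ (Z ⊗ W)) :=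
  idc (esym (tensAA X Y Z W)).

End StructuralIdentities.

Arguments assoc {C} X Y Z.
Arguments assocV {C} X Y Z.
Arguments lunit {C} X.
Arguments lunitV {C} X.
Arguments runit {C} X.
Arguments runitV {C} X.
Arguments assoc4 {C} X Y Z W.
Arguments assoc4V {C} X Y Z W.

Record strictBraidedCat := StrictBraidedCat {
  smcat :> strictMonCat;
  braid : forall X Y : smcat, Hom (X ⊗ Y) (Y ⊗ X);
  braidV : forall X Y : smcat, Hom (Y ⊗ X) (X ⊗ Y);
  braidVK : forall X Y : smcat, braid X Y ∘ braidV X Y = idm (Y ⊗ X);
  braidK : forall X Y : smcat, braidV X Y ∘ braid X Y = idm (X ⊗ Y);
  braid_nat : forall (X X' Y Y' : smcat) (f : Hom X X') (g : Hom Y Y'),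
    braid X' Y' ∘ (f ⊠ g) = (g ⊠ f) ∘ braid X Y;
  braid_tensr : forall X Y Z : smcat,
    braid X (Y ⊗ Z)
    = assocV Y Z X ∘ (Y ◁ braid X Z) ∘ assoc Y X Z ∘ (braid X Y ▷ Z)
      ∘ assocV X Y Z;
  braid_tensl : forall X Y Z : smcat,
    braid (X ⊗ Y) Z
    = assoc Z X Y ∘ (braid X Z ▷ Y) ∘ assocV X Z Y ∘ (X ◁ braid Y Z)
      ∘ assoc X Y Z }.

Arguments braid {s} X Y.

(* X ⊗ c_{Y,Z} ⊗ W *)
Definition midbraid (C : strictBraidedCat) (X Y Z W : C) :
    Hom ((X ⊗ Y) ⊗ (Z ⊗ W)) ((X ⊗ Z) ⊗ (Y ⊗ W)) :=
  assoc4V X Z Y W ∘ ((X ◁ braid Y Z) ▷ W) ∘ assoc4 X Y Z W.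

Arguments midbraid {C} X Y Z W.

Section Hopf.
Variable C : strictBraidedCat.
Implicit Types X Y : C.

Record algData X := AlgData {
  aunit : Hom unitO X;
  amul : Hom (X ⊗ X) X }.

Record coalgData X := CoalgData {
  acounit : Hom X unitO;
  acomul : Hom X (X ⊗ X) }.

Definition is_algebra X (A : algData X) : Prop :=
  [/\ amul A ∘ (aunit A ▷ X) = lunit X,
      amul A ∘ (X ◁ amul A) ∘ assoc X X X = amul A ∘ (amul A ▷ X)
    & amul A ∘ (X ◁ aunit A) = runit X].

Definition is_coalgebra X (D : coalgData X) : Prop :=
  [/\ (acounit D ▷ X) ∘ acomul D = lunitV X,
      assoc X X X ∘ (acomul D ▷ X) ∘ acomul D = (X ◁ acomul D) ∘ acomul D
    & (X ◁ acounit D) ∘ acomul D = runitV X].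

Definition is_alg_morphism X Y (A : algData X) (B : algData Y) (f : Hom X Y)
  : Prop :=
  f ∘ aunit A = aunit B /\ f ∘ amul A = amul B ∘ (f ⊠ f).

Definition is_coalg_morphism X Y (D : coalgData X) (E : coalgData Y)
    (f : Hom X Y) : Prop :=
  acounit E ∘ f = acounit D /\ acomul E ∘ f = (f ⊠ f) ∘ acomul D.

Definition unit_alg : algData (unitO : C) :=
  AlgData (idm unitO) (lunit unitO).

Definition tens_alg X Y (A : algData X) (B : algData Y) : algData (X ⊗ Y) :=
  AlgData ((aunit A ⊠ aunit B) ∘ lunitV unitO)
          ((amul A ⊠ amul B) ∘ midbraid X Y X Y).

Definition tens_coalg X Y (D : coalgData X) (E : coalgData Y)
  : coalgData (X ⊗ Y) :=
  CoalgData (lunit unitO ∘ (acounit D ⊠ acounit E))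
            (midbraid X X Y Y ∘ (acomul D ⊠ acomul E)).

Definition is_bialgebra X (A : algData X) (D : coalgData X) : Prop :=
  [/\ is_algebra A, is_coalgebra D,
      is_alg_morphism A unit_alg (acounit D)
    & is_alg_morphism A (tens_alg A A) (acomul D)].

Record hopfData X := HopfData {
  halg :> algData X;
  hcoalg :> coalgData X;
  antipode : Hom X X }.

Definition is_hopf X (H : hopfData X) : Prop :=
  [/\ is_bialgebra H H,
      amul H ∘ (X ◁ antipode H) ∘ acomul H = aunit H ∘ acounit H
    & amul H ∘ (antipode H ▷ X) ∘ acomul H = aunit H ∘ acounit H].

Definition cocommutative X (D : coalgData X) : Prop :=
  braid X X ∘ acomul D = acomul D.

End Hopf.

Section Finite.
Variable C : strictMonCat.

(* P ⊗ - and Q ⊗ - are C-functors through the right action of C on itself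
   (P ⊗ (X ⊗ Y) = (P ⊗ X) ⊗ Y); a C-adjunction is an adjunction whose unit and
   counit are compatible with this action. *)
Record Cadjunction (P Q : C) := CAdjunction {
  adj_unit : forall X : C, Hom X (Q ⊗ (P ⊗ X));
  adj_counit : forall X : C, Hom (P ⊗ (Q ⊗ X)) X;
  adj_unit_nat : forall (X Y : C) (f : Hom X Y),
    adj_unit Y ∘ f = (Q ◁ (P ◁ f)) ∘ adj_unit X;
  adj_counit_nat : forall (X Y : C) (f : Hom X Y),
    adj_counit Y ∘ (P ◁ (Q ◁ f)) = f ∘ adj_counit X;
  adj_trianglel : forall X : C,
    adj_counit (P ⊗ X) ∘ (P ◁ adj_unit X) = idm (P ⊗ X);
  adj_triangler : forall X : C,
    (Q ◁ adj_counit X) ∘ adj_unit (Q ⊗ X) = idm (Q ⊗ X);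
  adj_unit_tens : forall X Y : C,
    adj_unit (X ⊗ Y)
    = (Q ◁ assoc P X Y) ∘ assoc Q (P ⊗ X) Y ∘ (adj_unit X ▷ Y);
  adj_counit_tens : forall X Y : C,
    adj_counit (X ⊗ Y) ∘ (P ◁ assoc Q X Y) ∘ assoc P (Q ⊗ X) Y
    = adj_counit X ▷ Y }.

Record finite (P : C) := Finite {
  dual : C;
  dual_adj : Cadjunction P dual }.

(* a_P and b_P: the unit and the counit of the adjunction evaluated at K. *)
Definition coev (P : C) (F : finite P) : Hom unitO (dual F ⊗ P) :=
  (dual F ◁ runit P) ∘ adj_unit (dual_adj F) unitO.

Definition ev (P : C) (F : finite P) : Hom (P ⊗ dual F) unitO :=
  adj_counit (dual_adj F) unitO ∘ (P ◁ runitV (dual F)).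

End Finite.

Section StrictnessFacts.
Variable C : strictMonCat.
Implicit Types X Y Z : C.

Lemma idc_irr X Y (e e' : X = Y) : idc e = idc e'.
Proof. by rewrite (proof_irrelevance _ e e'). Qed.

Lemma idc_comp X Y Z (e : Y = Z) (e' : X = Y) :
  idc e ∘ idc e' = idc (eq_trans e' e).
Proof. by case: Z / e; rewrite comp_idl. Qed.

Lemma idc_id X (e : X = X) : idc e = idm X.
Proof. exact: (idc_irr e erefl). Qed.

Lemma tensm_idc_l X Y Z (e : X = Y) :
  idc e ▷ Z = idc (f_equal (fun W => W ⊗ Z) e).
Proof. by case: Y / e; rewrite tensm_id. Qed.

Lemma tensm_idc_r X Y Z (e : X = Y) :
  Z ◁ idc e = idc (f_equal (fun W => Z ⊗ W) e).
Proof. by case: Y / e; rewrite tensm_id. Qed.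

End StrictnessFacts.

Ltac idc_norm :=
  rewrite /assoc /assocV /lunit /lunitV /runit /runitV
    ?(tensm_idc_l, tensm_idc_r, idc_comp).

Lemma zigzag_l (C : strictMonCat) (P : C) (F : finite P) :
  lunit P ∘ (ev F ▷ P) ∘ assocV P (dual F) P ∘ (P ◁ coev F) ∘ runitV P = idm P.
Proof.
case: F => Q A; rewrite /ev /coev /=.
rewrite -{2}(comp_idl (idm P)) tensm_comp -adj_counit_tens.
have -> : lunit P ∘ (adj_counit A (unitO ⊗ P) ∘ (P ◁ assoc Q unitO P)
    ∘ assoc P (Q ⊗ unitO) P ∘ ((P ◁ runitV Q) ▷ P)) ∘ assocV P Q P
  = adj_counit A P.
  transitivity (adj_counit A P ∘ idm _); last by rewrite comp_idr.
  rewrite -!comp_assoc (comp_assoc (lunit P)) -adj_counit_nat -!comp_assoc.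
  congr (_ ∘ _).
  by idc_norm; rewrite idc_id.
rewrite -{1}(comp_idl (idm P)) tensm_comp comp_assoc adj_counit_nat.
rewrite -(comp_assoc (runit P)) adj_trianglel comp_idr.
by idc_norm; rewrite idc_id.
Qed.

Lemma zigzag_r (C : strictMonCat) (P : C) (F : finite P) :
  runit (dual F) ∘ (dual F ◁ ev F) ∘ assoc (dual F) P (dual F)
    ∘ (coev F ▷ dual F) ∘ lunitV (dual F) = idm (dual F).
Proof.
case: F => Q A; rewrite /ev /coev /=.
have E : adj_unit A Q = (Q ◁ (P ◁ lunit Q)) ∘ ((Q ◁ assoc P unitO Q)
    ∘ assoc Q (P ⊗ unitO) Q ∘ (adj_unit A unitO ▷ Q)) ∘ lunitV Q.
  rewrite -adj_unit_tens -adj_unit_nat -comp_assoc.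
  by idc_norm; rewrite idc_id comp_idr.
have -> : runit Q ∘ (Q ◁ (adj_counit A unitO ∘ (P ◁ runitV Q))) ∘ assoc Q P Q
    ∘ (((Q ◁ runit P) ∘ adj_unit A unitO) ▷ Q) ∘ lunitV Q
  = runit Q ∘ (Q ◁ adj_counit A unitO) ∘ ((Q ◁ (P ◁ runitV Q)) ∘ adj_unit A Q).
  rewrite E -{1}(comp_idl (idm Q)) tensm_comp.
  rewrite -{4}(comp_idl (idm Q)) tensm_comp !comp_assoc.
  congr (_ ∘ _ ∘ _); rewrite -!comp_assoc; congr (_ ∘ (_ ∘ _)).
  by idc_norm; apply: idc_irr.
rewrite -adj_unit_nat comp_assoc -(comp_assoc (runit Q)) adj_triangler comp_idr.
by idc_norm; rewrite idc_id.
Qed.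

Section PostHopf.
Variable C : strictBraidedCat.
Variable X : C.

Section Operations.
Variables (A : algData X) (D : coalgData X) (m : Hom (X ⊗ X) X).

(* μ ∘ (X ⊗ m) ∘ (δ ⊗ X) *)
Definition mul_hat : Hom (X ⊗ X) X :=
  amul A ∘ (X ◁ m) ∘ assoc X X X ∘ (acomul D ▷ X).

Variable F : finite X.

Definition alpha : Hom X (dual F ⊗ X) :=
  (dual F ◁ m) ∘ assoc (dual F) X X ∘ (braid X (dual F) ▷ X)
  ∘ assocV X (dual F) X ∘ (X ◁ coev F) ∘ runitV X.

(* Convolution product of X -> X^* ⊗ X, and its neutral element ε ⊗ a. *)
Definition conv (f g : Hom X (dual F ⊗ X)) : Hom X (dual F ⊗ X) :=
  (runit (dual F) ▷ X) ∘ ((dual F ◁ ev F) ▷ X)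
  ∘ assoc4 (dual F) X (dual F) X ∘ (f ⊠ g) ∘ acomul D.

Definition conv_unit : Hom X (dual F ⊗ X) :=
  lunit (dual F ⊗ X) ∘ (acounit D ⊠ coev F) ∘ runitV X.

Definition conv_inverse (f g : Hom X (dual F ⊗ X)) : Prop :=
  conv f g = conv_unit /\ conv g f = conv_unit.

Definition tilde (f : Hom X (dual F ⊗ X)) : Hom (X ⊗ X) X :=
  lunit X ∘ (ev F ▷ X) ∘ assocV X (dual F) X ∘ (X ◁ f).

Definition antipode_hat (l : Hom X X) (b : Hom X (dual F ⊗ X)) : Hom X X :=
  tilde b ∘ braid X X ∘ (X ◁ l) ∘ acomul D.

End Operations.

Definition is_post_hopf (H : hopfData X) (F : finite X) (m : Hom (X ⊗ X) X)
  : Prop :=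
  is_hopf H /\
  [/\ is_coalg_morphism (tens_coalg H H) H m,
      m ∘ (X ◁ m) ∘ assoc X X X = m ∘ (mul_hat H H m ▷ X),
      m ∘ (X ◁ amul H)
      = amul H ∘ (m ⊠ m) ∘ midbraid X X X X ∘ (acomul H ▷ (X ⊗ X))
    & exists b, conv_inverse H (alpha m F) b].

(* Γ = μ1 ∘ (λ1 ⊗ μ2) ∘ (δ ⊗ X) *)
Definition brace_action (D : coalgData X) (A1 : algData X) (l1 : Hom X X)
    (A2 : algData X) : Hom (X ⊗ X) X :=
  amul A1 ∘ (l1 ⊠ amul A2) ∘ assoc X X X ∘ (acomul D ▷ X).

Definition is_hopf_brace (D : coalgData X) (A1 : algData X) (l1 : Hom X X)
    (A2 : algData X) (l2 : Hom X X) : Prop :=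
  [/\ is_hopf (HopfData A1 D l1), is_hopf (HopfData A2 D l2)
    & amul A2 ∘ (X ◁ amul A1)
      = amul A1 ∘ (amul A2 ⊠ brace_action D A1 l1 A2) ∘ midbraid X X X X
        ∘ (acomul D ▷ (X ⊗ X))].

Definition is_cocommutative_hopf_brace (D : coalgData X) (A1 : algData X)
    (l1 : Hom X X) (A2 : algData X) (l2 : Hom X X) : Prop :=
  is_hopf_brace D A1 l1 A2 l2 /\ cocommutative D.

End PostHopf.

(* Main.v *)
(* A cocommutative Hopf algebra X satisfies c ∘ c = id on X ⊗ X (Schauenburg):
   applying c^-1 ∘ δ = δ to the compatibility of δ and μ gives the same
   compatibility with c^-1 in place of c, and the antipode allows one to solve
   it for the braiding.  Hence X ⊗ X and X ⊗ X ⊗ X are cocommutative coalgebras,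
   with projections that are coalgebra morphisms, so an identity between
   morphisms X ⊗ ... ⊗ X -> X only needs to be checked on generalized elements,
   i.e. coalgebra morphisms T -> X from a cocommutative coalgebra T.  These form
   a group under convolution, on which m acts by group endomorphisms
   f ▷ _ = m ∘ ⟨f, _⟩ with f ▷ (g ▷ h) = (f (f ▷ g)) ▷ h and with inverse
   operation given by the transpose of beta.  The claim thus reduces to
   the set-theoretic statement that f ∘ g = f (f ▷ g) makes a group with an
   invertible such action into a skew left brace, where the ∘-inverse of f is
   f ▷^-1 (f^-1). *)
Require Import Defs.
From mathcomp Require Import ssreflect ssrfun ssrbool.
Set Implicit Arguments.
Unset Strict Implicit.
Unset Printing Implicit Defensive.
Local Open Scope cat_scope.

(** * Tailed forms of morphisms *)

Section Chains.
Variable C : strictMonCat.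
Implicit Types P Q R Z S : C.

(** Composites are kept right-nested, so an equation between composites has to be usable in front of
    an arbitrary tail [s]. *)
Lemma chain2 P Q R S (g : Hom Q R) (f : Hom P Q) (r : Hom P R) (E : g ∘ f = r)
    (s : Hom S P) : g ∘ (f ∘ s) = r ∘ s.
Proof. by rewrite -E comp_assoc. Qed.

Lemma chain3 P Q R Z S (h : Hom R Z) (g : Hom Q R) (f : Hom P Q) (r : Hom P Z)
    (E : h ∘ (g ∘ f) = r) (s : Hom S P) : h ∘ (g ∘ (f ∘ s)) = r ∘ s.
Proof. by rewrite -E !comp_assoc. Qed.

Lemma chain4 P Q R Z Y S (k : Hom Z Y) (h : Hom R Z) (g : Hom Q R) (f : Hom P Q)
    (r : Hom P Y) (E : k ∘ (h ∘ (g ∘ f)) = r) (s : Hom S P) :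
  k ∘ (h ∘ (g ∘ (f ∘ s))) = r ∘ s.
Proof. by rewrite -E !comp_assoc. Qed.

Lemma whl_comp P Q R S (g : Hom R S) (f : Hom Q R) :
  P ◁ (g ∘ f) = (P ◁ g) ∘ (P ◁ f).
Proof. by rewrite -tensm_comp comp_idl. Qed.

Lemma whr_comp P Q R S (g : Hom R S) (f : Hom Q R) :
  (g ∘ f) ▷ P = (g ▷ P) ∘ (f ▷ P).
Proof. by rewrite -tensm_comp comp_idl. Qed.

Lemma whl2 P Q R S (g : Hom R S) (f : Hom Q R) (r : Hom Q S) (E : g ∘ f = r) :
  (P ◁ g) ∘ (P ◁ f) = P ◁ r.
Proof. by rewrite -E whl_comp. Qed.

Lemma whl3 P Q R S T (h : Hom S T) (g : Hom R S) (f : Hom Q R) (r : Hom Q T)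
    (E : h ∘ (g ∘ f) = r) : (P ◁ h) ∘ ((P ◁ g) ∘ (P ◁ f)) = P ◁ r.
Proof. by rewrite -E !whl_comp. Qed.

Lemma whl_whr P P' Q Q' (f : Hom P P') (g : Hom Q Q') :
  (P' ◁ g) ∘ (f ▷ Q) = (f ▷ Q') ∘ (P ◁ g).
Proof. by rewrite -!tensm_comp !comp_idl !comp_idr. Qed.

Lemma tensm_split P P' Q Q' (f : Hom P P') (g : Hom Q Q') :
  f ⊠ g = (f ▷ Q') ∘ (P ◁ g).
Proof. by rewrite -tensm_comp comp_idl comp_idr. Qed.

Lemma idc_compA P Q R S (e : Q = R) (e' : P = Q) (s : Hom S P) :
  idc e ∘ (idc e' ∘ s) = idc (eq_trans e' e) ∘ s.
Proof. by rewrite comp_assoc idc_comp. Qed.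

Lemma whr_whl P Q R Z (f : Hom Q R) :
  (P ◁ f) ▷ Z = assocV P R Z ∘ ((P ◁ (f ▷ Z)) ∘ assoc P Q Z).
Proof.
by rewrite -tensmA comp_assoc /assocV idc_comp idc_id comp_idl.
Qed.

Lemma whr_whr P Q R Z (f : Hom Q R) :
  (f ▷ P) ▷ Z = assocV R P Z ∘ ((f ▷ (P ⊗ Z)) ∘ assoc Q P Z).
Proof.
by rewrite -tensm_id -tensmA comp_assoc /assocV idc_comp idc_id comp_idl.
Qed.

(** At [Z = unitO] whiskering gives the morphism back up to casts. Through this lemma equations
    proved in tailed form return to plain ones. *)
Lemma whr_inj P Q (f g : Hom P Q) : (forall Z, f ▷ Z = g ▷ Z) -> f = g.
Proof.
move=> E; have: f ∘ idc (tensX1 P) = g ∘ idc (tensX1 P).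
  by rewrite -!tensmf1 E.
move/(congr1 (fun k => k ∘ idc (esym (tensX1 P)))).
by rewrite -!comp_assoc idc_comp idc_id !comp_idr.
Qed.

Lemma whl_tens P Q R S (f : Hom R S) :
  (P ⊗ Q) ◁ f = assocV P Q S ∘ ((P ◁ (Q ◁ f)) ∘ assoc P Q R).
Proof.
by rewrite -(tensm_id P Q) -tensmA comp_assoc /assocV idc_comp idc_id comp_idl.
Qed.

(* A morphism from a k-fold to an l-fold tensor product acts, as w<k><l>, on the
   head of a right-nested tensor product ending in Z, so that equations between
   such morphisms contain no associativity casts.  The definitions are locked
   because matching [_ ∘ _] would otherwise unfold them. *)
Definition w12 P Q R (f : Hom P (Q ⊗ R)) Z : Hom (P ⊗ Z) (Q ⊗ (R ⊗ Z)) :=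
  locked (assoc Q R Z ∘ (f ▷ Z)).
Definition w21 P Q R (f : Hom (P ⊗ Q) R) Z : Hom (P ⊗ (Q ⊗ Z)) (R ⊗ Z) :=
  locked ((f ▷ Z) ∘ assocV P Q Z).
Definition w22 P Q R S (f : Hom (P ⊗ Q) (R ⊗ S)) Z
  : Hom (P ⊗ (Q ⊗ Z)) (R ⊗ (S ⊗ Z)) :=
  locked (assoc R S Z ∘ ((f ▷ Z) ∘ assocV P Q Z)).
Definition w10 P (f : Hom P unitO) Z : Hom (P ⊗ Z) Z :=
  locked (lunit Z ∘ (f ▷ Z)).
Definition w01 P (f : Hom unitO P) Z : Hom Z (P ⊗ Z) :=
  locked ((f ▷ Z) ∘ lunitV Z).
Definition w20 P Q (f : Hom (P ⊗ Q) unitO) Z : Hom (P ⊗ (Q ⊗ Z)) Z :=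
  locked (lunit Z ∘ ((f ▷ Z) ∘ assocV P Q Z)).
Definition w02 P Q (f : Hom unitO (P ⊗ Q)) Z : Hom Z (P ⊗ (Q ⊗ Z)) :=
  locked (assoc P Q Z ∘ ((f ▷ Z) ∘ lunitV Z)).

Lemma w12E P Q R (f : Hom P (Q ⊗ R)) Z : w12 f Z = assoc Q R Z ∘ (f ▷ Z).
Proof. by rewrite /w12 -lock. Qed.
Lemma w21E P Q R (f : Hom (P ⊗ Q) R) Z : w21 f Z = (f ▷ Z) ∘ assocV P Q Z.
Proof. by rewrite /w21 -lock. Qed.
Lemma w22E P Q R S (f : Hom (P ⊗ Q) (R ⊗ S)) Z :
  w22 f Z = assoc R S Z ∘ ((f ▷ Z) ∘ assocV P Q Z).
Proof. by rewrite /w22 -lock. Qed.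
Lemma w10E P (f : Hom P unitO) Z : w10 f Z = lunit Z ∘ (f ▷ Z).
Proof. by rewrite /w10 -lock. Qed.
Lemma w01E P (f : Hom unitO P) Z : w01 f Z = (f ▷ Z) ∘ lunitV Z.
Proof. by rewrite /w01 -lock. Qed.
Lemma w20E P Q (f : Hom (P ⊗ Q) unitO) Z :
  w20 f Z = lunit Z ∘ ((f ▷ Z) ∘ assocV P Q Z).
Proof. by rewrite /w20 -lock. Qed.
Lemma w02E P Q (f : Hom unitO (P ⊗ Q)) Z :
  w02 f Z = assoc P Q Z ∘ ((f ▷ Z) ∘ lunitV Z).
Proof. by rewrite /w02 -lock. Qed.

End Chains.

(* Merges all casts in a right-nested chain; loops become identities, and any
   two parallel casts agree by proof irrelevance. *)
Ltac idc_unfold :=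
  unfold assoc, assocV, lunit, lunitV, runit, runitV, assoc4, assoc4V.
Ltac idc_simp :=
  rewrite ?(whl_comp, whr_comp, tensm_idc_l, tensm_idc_r) -?comp_assoc
    ?(idc_comp, idc_compA, idc_id, comp_idl, comp_idr, tensm_id).
Ltac idc_close := do ?congr (_ ∘ _); try apply: idc_irr.
Ltac idc_done := idc_unfold; idc_simp; first [reflexivity | by idc_close].
Ltac cn := rewrite ?whl_comp -?comp_assoc ?(tensm_id, comp_idl, comp_idr).
(* Rewrites with an equation between composites inside a right-nested chain. *)
Ltac crw E :=
  first [rewrite (chain4 E) | rewrite (chain3 E) | rewrite (chain2 E) | rewrite E];
  cn.
Ltac crwV E :=
  first [rewrite (chain4 (esym E)) | rewrite (chain3 (esym E))
    | rewrite (chain2 (esym E)) | rewrite -E];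
  cn.

(** * Passage between whiskered and tailed forms, and naturality in the tail *)

Section Tailed.
Variable C : strictMonCat.
Implicit Types P Q R Z S : C.

Lemma whr12 P Q R (f : Hom P (Q ⊗ R)) Z : f ▷ Z = assocV Q R Z ∘ w12 f Z.
Proof. by rewrite !w12E; idc_unfold; idc_simp. Qed.
Lemma whr21 P Q R (f : Hom (P ⊗ Q) R) Z : f ▷ Z = w21 f Z ∘ assoc P Q Z.
Proof. by rewrite !w21E; idc_unfold; idc_simp. Qed.
Lemma whr22 P Q R S (f : Hom (P ⊗ Q) (R ⊗ S)) Z :
  f ▷ Z = assocV R S Z ∘ (w22 f Z ∘ assoc P Q Z).
Proof. by rewrite !w22E; idc_unfold; idc_simp. Qed.
Lemma whr10 P (f : Hom P unitO) Z : f ▷ Z = lunitV Z ∘ w10 f Z.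
Proof. by rewrite !w10E; idc_unfold; idc_simp. Qed.
Lemma whr01 P (f : Hom unitO P) Z : f ▷ Z = w01 f Z ∘ lunit Z.
Proof. by rewrite !w01E; idc_unfold; idc_simp. Qed.
Lemma whr20 P Q (f : Hom (P ⊗ Q) unitO) Z :
  f ▷ Z = lunitV Z ∘ (w20 f Z ∘ assoc P Q Z).
Proof. by rewrite !w20E; idc_unfold; idc_simp. Qed.
Lemma whr02 P Q (f : Hom unitO (P ⊗ Q)) Z :
  f ▷ Z = assocV P Q Z ∘ (w02 f Z ∘ lunit Z).
Proof. by rewrite !w02E; idc_unfold; idc_simp. Qed.

Lemma lunit_nat P Q (f : Hom P Q) : f ∘ lunit P = lunit Q ∘ (unitO ◁ f).
Proof. by rewrite tensm1f. Qed.

Lemma assoc_nat P P' Q Q' Z Z' (f : Hom P P') (g : Hom Q Q') (h : Hom Z Z') :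
  (f ⊠ (g ⊠ h)) ∘ assoc P Q Z = assoc P' Q' Z' ∘ ((f ⊠ g) ⊠ h).
Proof. by rewrite /assoc tensmA. Qed.

Lemma assocV_nat P P' Q Q' Z Z' (f : Hom P P') (g : Hom Q Q') (h : Hom Z Z') :
  ((f ⊠ g) ⊠ h) ∘ assocV P Q Z = assocV P' Q' Z' ∘ (f ⊠ (g ⊠ h)).
Proof.
transitivity (assocV P' Q' Z' ∘ ((f ⊠ (g ⊠ h)) ∘ assoc P Q Z) ∘ assocV P Q Z).
  by rewrite assoc_nat; idc_unfold; idc_simp.
by idc_unfold; idc_simp.
Qed.

Lemma w12_nat P Q R (f : Hom P (Q ⊗ R)) Z W (k : Hom Z W) :
  (Q ◁ (R ◁ k)) ∘ w12 f Z = w12 f W ∘ (P ◁ k).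
Proof.
by rewrite !w12E comp_assoc assoc_nat tensm_id -!comp_assoc whl_whr.
Qed.
Lemma w21_nat P Q R (f : Hom (P ⊗ Q) R) Z W (k : Hom Z W) :
  (R ◁ k) ∘ w21 f Z = w21 f W ∘ (P ◁ (Q ◁ k)).
Proof.
by rewrite !w21E comp_assoc whl_whr -!comp_assoc -assocV_nat tensm_id.
Qed.
Lemma w22_nat P Q R S (f : Hom (P ⊗ Q) (R ⊗ S)) Z W (k : Hom Z W) :
  (R ◁ (S ◁ k)) ∘ w22 f Z = w22 f W ∘ (P ◁ (Q ◁ k)).
Proof.
rewrite !w22E comp_assoc assoc_nat tensm_id -!comp_assoc.
by rewrite -assocV_nat tensm_id (comp_assoc _ (f ▷ Z)) whl_whr !comp_assoc.
Qed.
Lemma w10_nat P (f : Hom P unitO) Z W (k : Hom Z W) :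
  k ∘ w10 f Z = w10 f W ∘ (P ◁ k).
Proof. by rewrite !w10E comp_assoc lunit_nat -!comp_assoc whl_whr. Qed.
Lemma w20_nat P Q (f : Hom (P ⊗ Q) unitO) Z W (k : Hom Z W) :
  k ∘ w20 f Z = w20 f W ∘ (P ◁ (Q ◁ k)).
Proof.
rewrite !w20E comp_assoc lunit_nat -!comp_assoc -assocV_nat tensm_id.
by rewrite (comp_assoc _ (f ▷ Z)) whl_whr !comp_assoc.
Qed.
End Tailed.

(** * Braiding *)

Section TailedBraiding.
Variable C : strictBraidedCat.
Local Notation bw P Q := (w22 (@braid C P Q)).
Local Notation bwV P Q := (w22 (@braidV C P Q)).
Implicit Types P Q R Z S : C.

Lemma braid_whr P Q Z :
  braid P Q ▷ Z = assocV Q P Z ∘ (w22 (braid P Q) Z ∘ assoc P Q Z).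
Proof. exact: whr22. Qed.

Lemma braidV_whr P Q Z :
  @braidV C P Q ▷ Z = assocV P Q Z ∘ (w22 (@braidV C P Q) Z ∘ assoc Q P Z).
Proof. exact: whr22. Qed.

Lemma bwK P Q Z : bwV P Q Z ∘ bw P Q Z = idm _.
Proof.
have := congr1 (fun k => assoc _ _ _ ∘ ((k ▷ Z) ∘ assocV _ _ _)) (braidK P Q).
rewrite whr_comp braid_whr braidV_whr; idc_done.
Qed.
Lemma bwVK P Q Z : bw P Q Z ∘ bwV P Q Z = idm _.
Proof.
have := congr1 (fun k => assoc _ _ _ ∘ ((k ▷ Z) ∘ assocV _ _ _)) (braidVK P Q).
rewrite whr_comp braid_whr braidV_whr; idc_done.
Qed.

Lemma bw_nat P P' Q Q' (f : Hom P P') (g : Hom Q Q') Z :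
  bw P' Q' Z ∘ ((f ▷ (Q' ⊗ Z)) ∘ (P ◁ (g ▷ Z)))
  = (g ▷ (P' ⊗ Z)) ∘ ((Q ◁ (f ▷ Z)) ∘ bw P Q Z).
Proof.
have := congr1 (fun k => assoc _ _ _ ∘ ((k ▷ Z) ∘ assocV _ _ _)) (braid_nat f g).
rewrite (tensm_split f g) (tensm_split g f) !whr_comp !whr_whl.
rewrite !whr_whr !braid_whr; idc_unfold.
by idc_simp.
Qed.

Lemma bw_natl P P' Q (f : Hom P P') Z :
  bw P' Q Z ∘ (f ▷ (Q ⊗ Z)) = (Q ◁ (f ▷ Z)) ∘ bw P Q Z.
Proof. by have := bw_nat f (idm Q) Z; rewrite !tensm_id comp_idr comp_idl. Qed.

Lemma bw_natr P Q Q' (g : Hom Q Q') Z :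
  bw P Q' Z ∘ (P ◁ (g ▷ Z)) = (g ▷ (P ⊗ Z)) ∘ bw P Q Z.
Proof. by have := bw_nat (idm P) g Z; rewrite !tensm_id !comp_idl. Qed.

Lemma bw_tensr P Q R Z :
  bw P (Q ⊗ R) Z
  = assocV Q R _ ∘ ((Q ◁ bw P R Z) ∘ (bw P Q (R ⊗ Z) ∘ (P ◁ assoc Q R Z))).
Proof.
have := congr1 (fun k => assocV _ _ _ ∘ (assoc _ _ _
  ∘ (assoc _ _ _ ∘ (k ▷ Z) ∘ assocV _ _ _))) (braid_tensr P Q R).
rewrite !whr_comp whr_whl whr_whr !braid_whr; idc_unfold; idc_simp => ->.
by idc_close.
Qed.

Lemma bw_tensl P Q R Z :
  bw (P ⊗ Q) R Z
  = (R ◁ assocV P Q Z) ∘ (bw P R (Q ⊗ Z) ∘ ((P ◁ bw Q R Z) ∘ assoc P Q _)).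
Proof.
have := congr1 (fun k => assoc _ _ _ ∘ ((k ▷ Z) ∘ assocV _ _ _)) (braid_tensl P Q R).
rewrite !whr_comp whr_whl whr_whr !braid_whr; idc_unfold; idc_simp => ->.
by idc_close.
Qed.

(** Triviality of the braiding with the unit object follows from the hexagon: up to casts the
    braiding is an endomorphism [u], which is idempotent and has the left inverse [v], hence is the
    identity. *)
Lemma bw_unitr P Z : bw P unitO Z = lunitV (P ⊗ Z) ∘ (P ◁ lunit Z).
Proof.
pose u := lunit (P ⊗ Z) ∘ (bw P unitO Z ∘ (P ◁ lunitV Z)).
pose v := (P ◁ lunit Z) ∘ (bwV P unitO Z ∘ lunitV (P ⊗ Z)).
have vu : v ∘ u = idm _.
  rewrite /u /v; idc_unfold; idc_simp; rewrite (chain2 (bwK _ _ _)).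
  by idc_simp.
have uu : u ∘ u = u.
  have eZ : Z = (unitO ⊗ unitO) ⊗ Z by rewrite !tens1X.
  (* Naturality along [unitO ⊗ unitO] → [unitO] compares one crossing with the two crossings
     produced by the hexagon, so [u] equals its own square. *)
  have := congr1 (fun k => lunit _ ∘ (k ∘ (P ◁ idc eZ)))
    (bw_natr P (lunit unitO) Z).
  rewrite bw_tensr -!comp_assoc.
  have -> : lunit (P ⊗ Z) ∘ (bw P unitO Z ∘ ((P ◁ (lunit unitO ▷ Z)) ∘ (P ◁ idc eZ)))
      = u.
    by rewrite /u; idc_unfold; idc_simp; idc_close.
  move=> {2}->.
  have -> : (unitO ◁ bw P unitO Z) = lunitV _ ∘ (bw P unitO Z ∘ lunit _).
    rewrite lunit_nat; idc_done.
  have -> : lunit (P ⊗ (unitO ⊗ Z)) = (P ◁ lunitV Z) ∘ (lunit _ ∘ (unitO ◁ (P ◁ lunit Z))).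
    by idc_unfold; idc_simp; apply: idc_irr.
  rewrite -!comp_assoc (chain2 (w22_nat _ _)) /u.
  idc_done.
have : v ∘ (u ∘ u) = v ∘ u by rewrite uu.
rewrite comp_assoc vu comp_idl => E.
transitivity (lunitV (P ⊗ Z) ∘ (u ∘ (P ◁ lunit Z))).
  rewrite /u; idc_done.
by rewrite E comp_idl.
Qed.

Lemma bw_unitl Q Z : bw unitO Q Z = (Q ◁ lunitV Z) ∘ lunit (Q ⊗ Z).
Proof.
pose u := (Q ◁ lunit Z) ∘ (bw unitO Q Z ∘ lunitV (Q ⊗ Z)).
pose v := lunit (Q ⊗ Z) ∘ (bwV unitO Q Z ∘ (Q ◁ lunitV Z)).
have vu : v ∘ u = idm _.
  rewrite /u /v; idc_unfold; idc_simp; rewrite (chain2 (bwK _ _ _)).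
  by idc_simp.
have uu : u ∘ u = u.
  have eZ : Q ⊗ Z = (unitO ⊗ unitO) ⊗ (Q ⊗ Z) by rewrite !tens1X.
  have := congr1 (fun k => (Q ◁ lunit Z) ∘ (k ∘ idc eZ))
    (bw_natl Q (lunit unitO) Z).
  rewrite bw_tensl -!comp_assoc.
  have -> : (Q ◁ lunit Z) ∘ (bw unitO Q Z ∘ ((lunit unitO ▷ (Q ⊗ Z)) ∘ idc eZ))
      = u.
    by rewrite /u; idc_unfold; idc_simp; idc_close.
  move=> {2}->.
  have -> : (unitO ◁ bw unitO Q Z) = lunitV _ ∘ (bw unitO Q Z ∘ lunit _).
    rewrite lunit_nat; idc_done.
  have -> : bw unitO Q (unitO ⊗ Z)
      = (Q ◁ (unitO ◁ lunitV Z)) ∘ (bw unitO Q Z ∘ (unitO ◁ (Q ◁ lunit Z))).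
    rewrite -(w22_nat (braid unitO Q) (lunit Z)); idc_done.
  have -> : (unitO ◁ (Q ◁ lunit Z)) = lunitV _ ∘ ((Q ◁ lunit Z) ∘ lunit _).
    rewrite lunit_nat; idc_done.
  rewrite /u; idc_done.
have : v ∘ (u ∘ u) = v ∘ u by rewrite uu.
rewrite comp_assoc vu comp_idl => E.
transitivity ((Q ◁ lunitV Z) ∘ (u ∘ lunit (Q ⊗ Z))).
  rewrite /u; idc_done.
by rewrite E comp_idl.
Qed.

(** Naturality and a hexagon combined: instead of the output of [f], its two inputs cross the strand
    one after the other. The next lemmas do the same for the other side and for other arities. *)
Lemma bw_w21l P Q R S (f : Hom (P ⊗ Q) R) Z :
  bw R S Z ∘ w21 f (S ⊗ Z)
  = (S ◁ w21 f Z) ∘ (bw P S (Q ⊗ Z) ∘ (P ◁ bw Q S Z)).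
Proof.
rewrite !w21E whl_comp comp_assoc bw_natl bw_tensl -!comp_assoc.
idc_done.
Qed.
Lemma bw_w21r P Q R S (f : Hom (P ⊗ Q) R) Z :
  bw S R Z ∘ (S ◁ w21 f Z)
  = w21 f (S ⊗ Z) ∘ ((P ◁ bw S Q Z) ∘ bw S P (Q ⊗ Z)).
Proof.
rewrite !w21E whl_comp comp_assoc bw_natr bw_tensr -!comp_assoc.
idc_done.
Qed.
Lemma bw_w12l P Q R S (f : Hom P (Q ⊗ R)) Z :
  (S ◁ w12 f Z) ∘ bw P S Z
  = bw Q S (R ⊗ Z) ∘ ((Q ◁ bw R S Z) ∘ w12 f (S ⊗ Z)).
Proof.
rewrite !w12E whl_comp -comp_assoc -bw_natl bw_tensl -!comp_assoc.
idc_done.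
Qed.
Lemma bw_w12r P Q R S (f : Hom P (Q ⊗ R)) Z :
  w12 f (S ⊗ Z) ∘ bw S P Z
  = (Q ◁ bw S R Z) ∘ (bw S Q (R ⊗ Z) ∘ (S ◁ w12 f Z)).
Proof.
rewrite !w12E whl_comp -comp_assoc -bw_natr bw_tensr -!comp_assoc.
idc_done.
Qed.
(** A pairing into the unit object can be pulled over a strand, because the braiding with [unitO] is
    trivial. *)
Lemma bw_w20r P Q S (f : Hom (P ⊗ Q) unitO) Z :
  S ◁ w20 f Z = w20 f (S ⊗ Z) ∘ ((P ◁ bw S Q Z) ∘ bw S P (Q ⊗ Z)).
Proof.
rewrite !w20E.
transitivity (lunit _ ∘ (bw S unitO Z ∘ ((S ◁ (f ▷ Z)) ∘ (S ◁ assocV _ _ _)))).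
  rewrite bw_unitr !whl_comp; idc_done.
rewrite (chain2 (bw_natr _ _ _)) bw_tensr -!comp_assoc.
idc_done.
Qed.
Lemma bw_w10r P S (f : Hom P unitO) Z :
  w10 f (S ⊗ Z) ∘ bw S P Z = S ◁ w10 f Z.
Proof.
rewrite !w10E -!comp_assoc -bw_natr bw_unitr whl_comp.
idc_done.
Qed.
Lemma bw_w10l P S (f : Hom P unitO) Z :
  (S ◁ w10 f Z) ∘ bw P S Z = w10 f (S ⊗ Z).
Proof.
rewrite !w10E whl_comp -!comp_assoc -bw_natl bw_unitl.
idc_done.
Qed.

End TailedBraiding.

(** * Tensor products of cocommutative coalgebras *)

Section TailedCoalgebra.
Variable C : strictBraidedCat.
Local Notation bw P Q := (w22 (@braid C P Q)).
Variables (T : C) (D : coalgData T).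
Hypothesis coalgD : is_coalgebra D.

Lemma coassoc_w Z :
  w12 (acomul D) (T ⊗ Z) ∘ w12 (acomul D) Z
  = (T ◁ w12 (acomul D) Z) ∘ w12 (acomul D) Z.
Proof.
have [_ E _] := coalgD.
have e : (T ⊗ (T ⊗ T)) ⊗ Z = T ⊗ (T ⊗ (T ⊗ Z)) by rewrite !tensA.
have := congr1 (fun k => idc e ∘ (k ▷ Z)) E.
rewrite !whr_comp whr_whl whr_whr !(whr12 (acomul D)).
idc_done.
Qed.

Lemma counitl_w Z : w10 (acounit D) (T ⊗ Z) ∘ w12 (acomul D) Z = idm _.
Proof.
have [E _ _] := coalgD.
have e : (unitO ⊗ T) ⊗ Z = T ⊗ Z by rewrite !tens1X.
have := congr1 (fun k => idc e ∘ (k ▷ Z)) E.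
rewrite !whr_comp whr_whr !(whr12 (acomul D)) (whr10 (acounit D)).
idc_done.
Qed.

Lemma counitr_w Z : (T ◁ w10 (acounit D) Z) ∘ w12 (acomul D) Z = idm _.
Proof.
have [_ _ E] := coalgD.
have e : (T ⊗ unitO) ⊗ Z = T ⊗ Z by rewrite !tensX1.
have := congr1 (fun k => idc e ∘ (k ▷ Z)) E.
rewrite !whr_comp whr_whl !(whr12 (acomul D)) (whr10 (acounit D)).
idc_done.
Qed.

Lemma cocomm_w (cocommD : cocommutative D) Z :
  bw T T Z ∘ w12 (acomul D) Z = w12 (acomul D) Z.
Proof.
have := congr1 (fun k => assoc _ _ _ ∘ (k ▷ Z)) cocommD.
rewrite !whr_comp braid_whr !(whr12 (acomul D)).
idc_done.
Qed.
End TailedCoalgebra.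

Definition tens_fst (C : strictMonCat) (T S : C) (e : Hom S unitO) : Hom (T ⊗ S) T :=
  runit T ∘ (T ◁ e).
Definition tens_snd (C : strictMonCat) (T S : C) (e : Hom T unitO) : Hom (T ⊗ S) S :=
  lunit S ∘ (e ▷ S).

Section TensorCoalgebra.
Variable C : strictBraidedCat.
Local Notation bw P Q := (w22 (@braid C P Q)).
Variables (T S : C) (D : coalgData T) (E : coalgData S).
Hypotheses (coalgD : is_coalgebra D) (coalgE : is_coalgebra E).
Local Notation dT := (w12 (acomul D)).
Local Notation dS := (w12 (acomul E)).

Lemma midbraid_whr P Q R U Z e e' :
  midbraid P Q R U ▷ Z = idc e ∘ ((P ◁ bw Q R (U ⊗ Z)) ∘ idc e').
Proof.
rewrite /midbraid !whr_comp !(whr_whr, whr_whl) !braid_whr; idc_done.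
Qed.

Lemma tens_comul_w Z :
  w12 (acomul (tens_coalg D E)) Z
  = assocV T S _ ∘ ((T ◁ (S ◁ assocV T S Z)) ∘ ((T ◁ bw T S (S ⊗ Z))
    ∘ (dT (S ⊗ (S ⊗ Z)) ∘ ((T ◁ dS Z) ∘ assoc T S Z)))).
Proof.
have e : T ⊗ (S ⊗ (T ⊗ (S ⊗ Z))) = ((T ⊗ S) ⊗ (T ⊗ S)) ⊗ Z by rewrite !tensA.
have e' : ((T ⊗ T) ⊗ (S ⊗ S)) ⊗ Z = T ⊗ (T ⊗ (S ⊗ (S ⊗ Z))) by rewrite !tensA.
rewrite {1}w12E /= (whr_comp _ (midbraid _ _ _ _)) (midbraid_whr e e').
rewrite (tensm_split (acomul D)) (whr_comp _ (_ ▷ _)).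
rewrite whr_whr whr_whl !(whr12 (acomul D)) !(whr12 (acomul E)).
have -> : w12 (acomul D) ((S ⊗ S) ⊗ Z)
    = (T ◁ (T ◁ assocV S S Z)) ∘ (dT (S ⊗ (S ⊗ Z)) ∘ (T ◁ assoc S S Z)).
  by rewrite -w12_nat comp_assoc -!whl_comp; idc_unfold; idc_simp.
idc_done.
Qed.

(* The coproduct of T ⊗ S on right-nested words. *)
Let dTS Z := locked ((T ◁ bw T S (S ⊗ Z)) ∘ (dT (S ⊗ (S ⊗ Z)) ∘ (T ◁ dS Z))).

Let tens_comul_dTS Z : w12 (acomul (tens_coalg D E)) Z
  = assocV T S _ ∘ ((T ◁ (S ◁ assocV T S Z)) ∘ (dTS Z ∘ assoc T S Z)).
Proof. by rewrite tens_comul_w /dTS -!lock; cn. Qed.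

Let dTS_nat Z W (k : Hom Z W) :
  (T ◁ (S ◁ (T ◁ (S ◁ k)))) ∘ dTS Z = dTS W ∘ (T ◁ (S ◁ k)).
Proof.
rewrite /dTS -!lock; crw (whl2 T (w22_nat (@braid C T S) (S ◁ k))).
crw (w12_nat (acomul D) (S ◁ (S ◁ k))).
by crw (whl2 T (w12_nat (acomul E) k)).
Qed.

(** The braidings slide past the coproducts of [T] and [S]; what remains is coassociativity in each
    factor. *)
Let dTS_coassoc Z :
  dTS (T ⊗ (S ⊗ Z)) ∘ dTS Z = (T ◁ (S ◁ dTS Z)) ∘ dTS Z.
Proof.
rewrite /dTS -!lock; cn.
crw (whl2 T (bw_w12r T (acomul E) (S ⊗ Z))).
crw (esym (w12_nat (acomul D) (S ◁ bw T S (S ⊗ Z)))).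
crw (esym (w12_nat (acomul D) (bw T S (S ⊗ (S ⊗ Z))))).
crw (w12_nat (acomul D) (dS (S ⊗ Z))).
crw (coassoc_w coalgD (S ⊗ (S ⊗ (S ⊗ Z)))).
crw (whl2 T (coassoc_w coalgE Z)).
crw (whl2 T (esym (w22_nat (@braid C T S) (bw T S (S ⊗ Z))))).
crw (whl2 T (w22_nat (@braid C T S) (dS Z))).
crw (w12_nat (acomul D) (S ◁ dS Z)).
crw (whl2 T (bw_w12l S (acomul D) (S ⊗ (S ⊗ Z)))).
by [].
Qed.

Local Notation eT := (w10 (acounit D)).
Local Notation eS := (w10 (acounit E)).

Lemma tens_counit_w Z :
  w10 (acounit (tens_coalg D E)) Z = eT Z ∘ ((T ◁ eS Z) ∘ assoc T S Z).
Proof.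
rewrite {1}w10E /= (tensm_split (acounit D)) !whr_comp.
rewrite whr_whr whr_whl !(whr10 (acounit D)) !(whr10 (acounit E)).
have -> : eT (unitO ⊗ Z) = lunitV Z ∘ (eT Z ∘ (T ◁ lunit Z)).
  rewrite -w10_nat; idc_done.
idc_done.
Qed.

Let eTS Z := locked (eT Z ∘ (T ◁ eS Z)).

Let eTS_nat Z W (k : Hom Z W) : k ∘ eTS Z = eTS W ∘ (T ◁ (S ◁ k)).
Proof.
rewrite /eTS -!lock; crw (w10_nat (acounit D) k).
by crw (whl2 T (w10_nat (acounit E) k)).
Qed.

Let eTS_l Z : eTS (T ⊗ (S ⊗ Z)) ∘ dTS Z = idm _.
Proof.
rewrite /eTS /dTS -!lock; cn.
crw (whl2 T (bw_w10r T (acounit E) (S ⊗ Z))).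
crw (w12_nat (acomul D) (eS (S ⊗ Z))).
by crw (whl2 T (counitl_w coalgE Z)); crw (counitl_w coalgD (S ⊗ Z)).
Qed.

Let eTS_r Z : (T ◁ (S ◁ eTS Z)) ∘ dTS Z = idm _.
Proof.
rewrite /eTS /dTS -!lock; cn.
crw (whl2 T (w22_nat (@braid C T S) (eS Z))).
crw (whl2 T (bw_w10l S (acounit D) Z)).
crw (w12_nat (acomul D) (S ◁ eS Z)).
by crw (whl2 T (counitr_w coalgE Z)); crw (counitr_w coalgD (S ⊗ Z)).
Qed.

Lemma tens_coalg_coalgebra : is_coalgebra (tens_coalg D E).
Proof.
move: (tens_coalg D E) tens_comul_dTS tens_counit_w => DE dE eE.
(* By naturality in the tail, the coproduct on the tail [(T ⊗ S) ⊗ Z] is reduced to the right-nested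
   word form. *)
have dE' Z : w12 (acomul DE) ((T ⊗ S) ⊗ Z)
    = assocV T S _ ∘ ((T ◁ (S ◁ idc (esym (tensA T S _))))
      ∘ ((T ◁ (S ◁ (T ◁ (S ◁ assocV T S Z)))) ∘ (dTS (T ⊗ (S ⊗ Z))
      ∘ ((T ◁ (S ◁ assoc T S Z)) ∘ assoc T S _)))).
  rewrite dE (chain2 (dTS_nat _)); idc_done.
have eE' Z : w10 (acounit DE) ((T ⊗ S) ⊗ Z)
    = assocV T S Z ∘ (eTS (T ⊗ (S ⊗ Z)) ∘ ((T ◁ (S ◁ assoc T S Z)) ∘ assoc T S _)).
  rewrite (chain2 (eTS_nat _)) eE /eTS -!lock; idc_done.
split; apply: whr_inj => Z.
- rewrite !whr_comp whr_whr !(whr12 (acomul DE)) (whr10 (acounit DE)) dE eE'.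
  idc_unfold; idc_simp; rewrite (chain2 (eTS_l Z)); idc_done.
- rewrite !whr_comp whr_whl whr_whr !(whr12 (acomul DE)) dE' dE whl_tens.
  idc_unfold; idc_simp.
  rewrite (chain2 (dTS_coassoc Z)); idc_done.
- rewrite !whr_comp whr_whl !(whr12 (acomul DE)) (whr10 (acounit DE)) dE eE whl_tens.
  have E1 := eTS_r Z; rewrite /eTS -!lock whl_comp whl_comp -comp_assoc in E1.
  idc_unfold; idc_simp; rewrite (chain3 E1); idc_done.
Qed.

Lemma tens_fst_whr Z : tens_fst T (acounit E) ▷ Z = (T ◁ eS Z) ∘ assoc T S Z.
Proof.
rewrite /tens_fst !whr_comp whr_whl (whr10 (acounit E)); idc_done.
Qed.

Lemma tens_snd_whr Z : tens_snd S (acounit D) ▷ Z = eT (S ⊗ Z) ∘ assoc T S Z.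
Proof.
rewrite /tens_snd !whr_comp whr_whr (whr10 (acounit D)); idc_done.
Qed.

Lemma tens_fst_coalg_morphism :
  is_coalg_morphism (tens_coalg D E) D (tens_fst T (acounit E)).
Proof.
move: (tens_fst T (acounit E)) tens_fst_whr => p pE.
split; apply: whr_inj => Z.
  rewrite whr_comp (whr10 (acounit (tens_coalg _ _))) tens_counit_w.
  rewrite (whr10 (acounit D)) pE; idc_done.
rewrite whr_comp (whr12 (acomul D)) whr_comp.
rewrite (whr12 (acomul (tens_coalg _ _))) tens_comul_dTS.
rewrite (tensm_split p p) whr_comp whr_whr whr_whl !pE.
rewrite whl_tens.
idc_unfold; idc_simp.
rewrite /dTS -!lock; cn.
crw (whl2 T (w22_nat (@braid C T S) (eS Z))).
crw (whl2 T (bw_w10r T (acounit E) Z)).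
crw (w12_nat (acomul D) (S ◁ eS Z)).
crw (w12_nat (acomul D) (eS Z)).
by crw (whl2 T (counitr_w coalgE Z)).
Qed.

Lemma tens_snd_coalg_morphism :
  is_coalg_morphism (tens_coalg D E) E (tens_snd S (acounit D)).
Proof.
move: (tens_snd S (acounit D)) tens_snd_whr => p pE.
split; apply: whr_inj => Z.
  rewrite whr_comp (whr10 (acounit (tens_coalg _ _))) tens_counit_w.
  rewrite (whr10 (acounit E)) pE; idc_unfold; idc_simp.
  rewrite (chain2 (w10_nat (acounit D) (eS Z))); cn; idc_done.
rewrite whr_comp (whr12 (acomul E)) whr_comp.
rewrite (whr12 (acomul (tens_coalg _ _))) tens_comul_dTS.
rewrite (tensm_split p p) whr_comp whr_whr whr_whl !pE.
rewrite whl_tens.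
idc_unfold; idc_simp.
rewrite /dTS -!lock; cn.
crw (whl2 T (bw_w10l S (acounit D) (S ⊗ Z))).
crw (counitr_w coalgD (S ⊗ (S ⊗ Z))).
by crw (w10_nat (acounit D) (dS Z)).
Qed.

(** The identity of [T ⊗ S] is thus a generic pair of elements, on which identities between
    morphisms out of [T ⊗ S] can be tested. *)
Lemma proj_pair : (tens_fst T (acounit E) ⊠ tens_snd S (acounit D))
  ∘ acomul (tens_coalg D E) = idm _.
Proof.
move: (tens_fst T (acounit E)) tens_fst_whr => p pE.
move: (tens_snd S (acounit D)) tens_snd_whr => q qE.
apply: whr_inj => Z.
rewrite whr_comp.
rewrite (whr12 (acomul (tens_coalg _ _))) tens_comul_dTS.
rewrite (tensm_split p q) whr_comp whr_whr whr_whl pE qE.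
rewrite whl_tens.
idc_unfold; idc_simp.
rewrite /dTS -!lock; cn.
crw (whl2 T (bw_w10l S (acounit D) (S ⊗ Z))).
crw (counitr_w coalgD (S ⊗ (S ⊗ Z))).
crw (whl2 T (counitl_w coalgE Z)).
by rewrite idc_comp idc_id.
Qed.

(** Exchanging the two copies of [T ⊗ S] puts a crossing of [S] and [T] right after the one inside
    the coproduct. [sym] cancels the two, and the crossings of equal factors are absorbed by [cD]
    and [cE]. *)
Lemma tens_coalg_cocomm : braid S T ∘ braid T S = idm _ ->
  cocommutative D -> cocommutative E -> cocommutative (tens_coalg D E).
Proof.
move=> sym cD cE; apply: whr_inj => Z.
rewrite whr_comp (whr12 (acomul (tens_coalg _ _))) tens_comul_dTS braid_whr.
rewrite bw_tensl !bw_tensr.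
idc_unfold; idc_simp.
rewrite /dTS -!lock; cn.
have := congr1 (fun k => assoc _ _ _ ∘ ((k ▷ (S ⊗ Z)) ∘ assocV _ _ _)) sym.
rewrite whr_comp !braid_whr; idc_unfold; idc_simp => symw.
crw (whl2 T symw).
crw (w12_nat (acomul D) (bw S S Z)).
crw (whl2 T (cocomm_w cE Z)).
crw (cocomm_w cD (S ⊗ (S ⊗ Z))).
idc_done.
Qed.
End TensorCoalgebra.

(** * The braiding of a cocommutative Hopf algebra is involutive *)

Section HopfBraiding.
Variable C : strictBraidedCat.
Local Notation bw P Q := (w22 (@braid C P Q)).
Local Notation bwV P Q := (w22 (@braidV C P Q)).
Variables (X : C) (H : hopfData X).
Hypothesis hopfH : is_hopf H.
Local Notation dw := (w12 (acomul H)).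
Local Notation ew := (w10 (acounit H)).
Local Notation mw := (w21 (amul H)).
Local Notation uw := (w01 (aunit H)).
Local Notation lw Z := (antipode H ▷ Z).

Lemma hopf_coalgebra : is_coalgebra H.
Proof. by case: hopfH => [[]]. Qed.

Lemma mulA_w Z : mw Z ∘ mw (X ⊗ Z) = mw Z ∘ (X ◁ mw Z).
Proof.
have [[[_ E _] _ _ _] _ _] := hopfH.
have e : X ⊗ (X ⊗ (X ⊗ Z)) = ((X ⊗ X) ⊗ X) ⊗ Z by rewrite !tensA.
have := congr1 (fun k => (k ▷ Z) ∘ idc e) E.
rewrite !whr_comp whr_whl whr_whr !(whr21 (amul H)).
by idc_unfold; idc_simp => ->.
Qed.

Lemma mul1_w Z : mw Z ∘ uw (X ⊗ Z) = idm _.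
Proof.
have [[[E _ _] _ _ _] _ _] := hopfH.
have e : X ⊗ Z = (unitO ⊗ X) ⊗ Z by rewrite !tens1X.
have := congr1 (fun k => (k ▷ Z) ∘ idc e) E.
rewrite !whr_comp whr_whr !(whr21 (amul H)) (whr01 (aunit H)).
idc_done.
Qed.

Lemma mulr1_w Z : mw Z ∘ (X ◁ uw Z) = idm _.
Proof.
have [[[_ _ E] _ _ _] _ _] := hopfH.
have e : X ⊗ Z = (X ⊗ unitO) ⊗ Z by rewrite !tensX1.
have := congr1 (fun k => (k ▷ Z) ∘ idc e) E.
rewrite !whr_comp whr_whl !(whr21 (amul H)) (whr01 (aunit H)).
idc_done.
Qed.

Lemma antipode_r_w Z : mw Z ∘ ((X ◁ lw Z) ∘ dw Z) = uw Z ∘ ew Z.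
Proof.
have [_ E _] := hopfH.
have := congr1 (fun k => k ▷ Z) E.
rewrite !whr_comp whr_whl !(whr21 (amul H)) (whr01 (aunit H)) (whr12 (acomul H)).
rewrite (whr10 (acounit H)); idc_done.
Qed.

Lemma antipode_l_w Z : mw Z ∘ (lw (X ⊗ Z) ∘ dw Z) = uw Z ∘ ew Z.
Proof.
have [_ _ E] := hopfH.
have := congr1 (fun k => k ▷ Z) E.
rewrite !whr_comp whr_whr !(whr21 (amul H)) (whr01 (aunit H)) (whr12 (acomul H)).
rewrite (whr10 (acounit H)); idc_done.
Qed.

Lemma comul_mul_w Z : dw Z ∘ mw Z =
  mw (X ⊗ Z) ∘ ((X ◁ (X ◁ mw Z)) ∘ ((X ◁ bw X X (X ⊗ Z))
  ∘ (dw (X ⊗ (X ⊗ Z)) ∘ (X ◁ dw Z)))).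
Proof.
have [[_ _ _ [_ E]] _ _] := hopfH.
have := congr1 (fun k => assoc _ _ _ ∘ ((k ▷ Z) ∘ assocV _ _ _)) E.
have e : X ⊗ (X ⊗ (X ⊗ (X ⊗ Z))) = ((X ⊗ X) ⊗ (X ⊗ X)) ⊗ Z by rewrite !tensA.
have e' : ((X ⊗ X) ⊗ (X ⊗ X)) ⊗ Z = X ⊗ (X ⊗ (X ⊗ (X ⊗ Z))) by rewrite !tensA.
rewrite /= (whr_comp _ (_ ∘ _)) (whr_comp _ _ (midbraid _ _ _ _)) (midbraid_whr e e').
rewrite (tensm_split (acomul H) (acomul H)) (tensm_split (amul H) (amul H)).
rewrite !whr_comp !whr_whr !whr_whl !(whr21 (amul H)) !(whr12 (acomul H)).
rewrite whl_tens.
have -> : dw ((X ⊗ X) ⊗ Z)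
    = (X ◁ (X ◁ assocV X X Z)) ∘ (dw (X ⊗ (X ⊗ Z)) ∘ (X ◁ assoc X X Z)).
  by rewrite -w12_nat comp_assoc -!whl_comp; idc_unfold; idc_simp.
idc_done.
Qed.

(** The map sending [k] to (μ ⊗ μ) ∘ (X ⊗ k ⊗ X) ∘ (δ ⊗ δ), called [P] below, is injective: the
    antipode strips off first the outer left strand, leaving [G], and then the outer right one. *)
Lemma mul_comul_cancel (g h : Hom (X ⊗ X) (X ⊗ X)) :
  (forall Z, mw (X ⊗ Z) ∘ ((X ◁ (X ◁ mw Z)) ∘ ((X ◁ w22 g (X ⊗ Z))
      ∘ (dw (X ⊗ (X ⊗ Z)) ∘ (X ◁ dw Z))))
    = mw (X ⊗ Z) ∘ ((X ◁ (X ◁ mw Z)) ∘ ((X ◁ w22 h (X ⊗ Z))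
      ∘ (dw (X ⊗ (X ⊗ Z)) ∘ (X ◁ dw Z))))) -> g = h.
Proof.
pose P (k : Hom (X ⊗ X) (X ⊗ X)) Z := mw (X ⊗ Z) ∘ ((X ◁ (X ◁ mw Z))
  ∘ ((X ◁ w22 k (X ⊗ Z)) ∘ (dw (X ⊗ (X ⊗ Z)) ∘ (X ◁ dw Z)))).
pose G (k : Hom (X ⊗ X) (X ⊗ X)) Z :=
  (X ◁ mw Z) ∘ (w22 k (X ⊗ Z) ∘ (X ◁ dw Z)).
(* A further copy of the left input is inserted through the antipode; after coassociativity and
   associativity it cancels against the left product. *)
have PG k Z : G k Z
    = mw (X ⊗ Z) ∘ (lw (X ⊗ (X ⊗ Z)) ∘ ((X ◁ P k Z) ∘ dw (X ⊗ Z))).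
  rewrite /P /G; cn.
  crw (w12_nat (acomul H) (dw Z)).
  crwV (coassoc_w hopf_coalgebra (X ⊗ (X ⊗ Z))).
  crwV (whl_whr (antipode H) (mw (X ⊗ Z))).
  crwV (mulA_w (X ⊗ Z)).
  crw (w12_nat (acomul H) (w22 k (X ⊗ Z))).
  crw (w12_nat (acomul H) (X ◁ mw Z)).
  crw (antipode_l_w (X ⊗ (X ⊗ Z))).
  crw (mul1_w (X ⊗ Z)).
  crwV (w10_nat (acounit H) (X ◁ mw Z)).
  crwV (w10_nat (acounit H) (w22 k (X ⊗ Z))).
  by crw (counitl_w hopf_coalgebra (X ⊗ (X ⊗ Z))).
(* The mirror argument on the right strand recovers [k] itself. *)
have Gk k Z : w22 k Z
    = (X ◁ mw Z) ∘ ((X ◁ (X ◁ lw Z)) ∘ (G k (X ⊗ Z) ∘ (X ◁ dw Z))).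
  rewrite /G; cn.
  crw (whl2 X (w21_nat (amul H) (lw Z))).
  crw (whl2 X (mulA_w Z)).
  crw (w22_nat k (X ◁ lw Z)).
  crw (whl2 X (coassoc_w hopf_coalgebra Z)).
  crw (w22_nat k (mw Z)).
  crw (whl3 X (whl3 X (antipode_r_w Z))).
  crwV (w22_nat k (uw Z)).
  crw (whl2 X (mulr1_w Z)).
  by crw (whl2 X (counitr_w hopf_coalgebra Z)).
move=> E; have PE Z : P g Z = P h Z by apply: E.
have GE Z : G g Z = G h Z by rewrite !PG PE.
by apply: whr_inj => Z; rewrite !whr22 !Gk GE.
Qed.

(** Since c^-1 ∘ δ = δ, the inverse braiding may be applied after δ ∘ μ. Pulled through both
    products it becomes four inverse crossings: one cancels the middle c, two are absorbed by the
    coproducts, and one remains in the middle. *)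
Lemma comul_mulV_w (cocommH : cocommutative H) Z : dw Z ∘ mw Z =
  mw (X ⊗ Z) ∘ ((X ◁ (X ◁ mw Z)) ∘ ((X ◁ bwV X X (X ⊗ Z))
  ∘ (dw (X ⊗ (X ⊗ Z)) ∘ (X ◁ dw Z)))).
Proof.
have cVd W : bwV X X W ∘ dw W = dw W.
  by rewrite -{1}(cocomm_w cocommH) comp_assoc bwK comp_idl.
have cVr W : bwV X X W ∘ (X ◁ mw W)
    = mw (X ⊗ W) ∘ ((X ◁ bwV X X W) ∘ bwV X X (X ⊗ W)).
  transitivity (bwV X X W ∘ ((X ◁ mw W) ∘ ((bw X X (X ⊗ W) ∘ ((X ◁ bw X X W)
      ∘ ((X ◁ bwV X X W) ∘ bwV X X (X ⊗ W))))))).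
    by crw (whl2 X (bwVK X X W)); crw (bwVK X X (X ⊗ W)).
  by crwV (bw_w21l X (amul H) W); crw (bwK X X W).
have cVl W : bwV X X W ∘ mw (X ⊗ W)
    = (X ◁ mw W) ∘ (bwV X X (X ⊗ W) ∘ (X ◁ bwV X X W)).
  transitivity (bwV X X W ∘ (mw (X ⊗ W) ∘ (((X ◁ bw X X W) ∘ (bw X X (X ⊗ W)
      ∘ (bwV X X (X ⊗ W) ∘ (X ◁ bwV X X W))))))).
    by crw (bwVK X X (X ⊗ W)); crw (whl2 X (bwVK X X W)).
  by crwV (bw_w21r X (amul H) W); crw (bwK X X W).
rewrite -{1}cVd -comp_assoc comul_mul_w; cn.
crw (cVl Z).
crw (whl2 X (cVr Z)).
crw (cVr (X ⊗ Z)).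
crw (whl2 X (bwK X X (X ⊗ Z))).
crw (w12_nat (acomul H) (bwV X X Z)).
crw (whl2 X (cVd Z)).
crw (cVd (X ⊗ (X ⊗ Z))).
by crw (w21_nat (amul H) (mw Z)).
Qed.

Lemma braid_involutive (cocommH : cocommutative H) :
  braid X X ∘ braid X X = idm _.
Proof.
have E : braid X X = @braidV C X X.
  apply: mul_comul_cancel => Z.
  by rewrite -comul_mul_w comul_mulV_w.
by rewrite {1}E braidK.
Qed.

End HopfBraiding.

(** * Coalgebra morphisms as generalized elements *)

Lemma coalg_morphism_comp (C : strictBraidedCat) (S T U : C) (D : coalgData S)
    (E : coalgData T) (F : coalgData U) (g : Hom T U) (f : Hom S T) :
  is_coalg_morphism E F g -> is_coalg_morphism D E f ->
  is_coalg_morphism D F (g ∘ f).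
Proof.
move=> [g0 g2] [f0 f2]; split; first by rewrite comp_assoc g0.
by rewrite comp_assoc g2 -comp_assoc f2 comp_assoc -tensm_comp.
Qed.

Section Elements.
Variable C : strictBraidedCat.
Variables (T : C) (D : coalgData T).
Hypothesis coalgD : is_coalgebra D.

(** For cocommutative [D] and coalgebra morphisms [f], [g] this is the generalized element of the
    tensor coalgebra with components [f] and [g]. It is locked so that rewriting composites does not
    open it. *)
Definition pair P Q (f : Hom T P) (g : Hom T Q) : Hom T (P ⊗ Q) :=
  locked ((f ⊠ g) ∘ acomul D).
Lemma pairE P Q (f : Hom T P) (g : Hom T Q) : pair f g = (f ⊠ g) ∘ acomul D.
Proof. by rewrite /pair -lock. Qed.
Local Notation "⟪ f , g ⟫" := (pair f g) (at level 0).

Lemma tens_pair P P' Q Q' (f : Hom P P') (g : Hom Q Q') (a : Hom T P)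
    (b : Hom T Q) : (f ⊠ g) ∘ ⟪a, b⟫ = ⟪f ∘ a, g ∘ b⟫.
Proof. by rewrite !pairE comp_assoc -tensm_comp. Qed.

Lemma whl_pair P Q Q' (g : Hom Q Q') (a : Hom T P) (b : Hom T Q) :
  (P ◁ g) ∘ ⟪a, b⟫ = ⟪a, g ∘ b⟫.
Proof. by rewrite tens_pair comp_idl. Qed.

Lemma whr_pair P P' Q (f : Hom P P') (a : Hom T P) (b : Hom T Q) :
  (f ▷ Q) ∘ ⟪a, b⟫ = ⟪f ∘ a, b⟫.
Proof. by rewrite tens_pair comp_idl. Qed.

Lemma pair_comp S (E : coalgData S) P Q (f : Hom S P) (g : Hom S Q)
    (h : Hom T S) : is_coalg_morphism D E h ->
  ((f ⊠ g) ∘ acomul E) ∘ h = ⟪f ∘ h, g ∘ h⟫.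
Proof. by move=> [_ h2]; rewrite -comp_assoc h2 !pairE comp_assoc -tensm_comp. Qed.

Lemma assoc_pair P Q R (a : Hom T P) (b : Hom T Q) (c : Hom T R) :
  assoc P Q R ∘ ⟪⟪a, b⟫, c⟫ = ⟪a, ⟪b, c⟫⟫.
Proof.
have [_ E _] := coalgD.
rewrite !pairE -{1}(comp_idr c) -{2}(comp_idr a) !tensm_comp -!comp_assoc -E.
by rewrite (comp_assoc (assoc _ _ _)) -assoc_nat !comp_assoc.
Qed.

Lemma assocV_pair P Q R (a : Hom T P) (b : Hom T Q) (c : Hom T R) :
  assocV P Q R ∘ ⟪a, ⟪b, c⟫⟫ = ⟪⟪a, b⟫, c⟫.
Proof. rewrite -assoc_pair; idc_unfold; by idc_simp. Qed.

Lemma lunit_pair P (a : Hom T P) : lunit P ∘ ⟪acounit D, a⟫ = a.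
Proof.
have [E _ _] := coalgD.
rewrite !pairE -(comp_idl (acounit D)) -{1}(comp_idr a) tensm_comp -comp_assoc E.
by rewrite comp_assoc -lunit_nat; idc_unfold; idc_simp.
Qed.

Lemma runit_pair P (a : Hom T P) : runit P ∘ ⟪a, acounit D⟫ = a.
Proof.
have [_ _ E] := coalgD.
rewrite !pairE -(comp_idl (acounit D)) -{1}(comp_idr a) tensm_comp -comp_assoc E.
by rewrite comp_assoc tensmf1; idc_unfold; idc_simp.
Qed.

Hypothesis cocommD : cocommutative D.

Lemma braid_pair P Q (a : Hom T P) (b : Hom T Q) : braid P Q ∘ ⟪a, b⟫ = ⟪b, a⟫.
Proof. by rewrite !pairE comp_assoc braid_nat -comp_assoc cocommD. Qed.

(** Regrouping brings the inner braiding onto [⟪b, c⟫], where cocommutativity of [D] turns it into a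
    swap. *)
Lemma midbraid_pair P Q R S (a : Hom T P) (b : Hom T Q) (c : Hom T R)
    (d : Hom T S) :
  midbraid P Q R S ∘ ⟪⟪a, b⟫, ⟪c, d⟫⟫ = ⟪⟪a, c⟫, ⟪b, d⟫⟫.
Proof.
rewrite /midbraid /assoc4 /assoc4V.
have -> : idc (tensAA P Q R S) = (assoc P Q R ▷ S) ∘ assocV (P ⊗ Q) R S.
  idc_done.
have -> : idc (esym (tensAA P R Q S)) = assoc (P ⊗ R) Q S ∘ (assocV P R Q ▷ S).
  idc_done.
rewrite -!comp_assoc assocV_pair !whr_pair assoc_pair whl_pair braid_pair.
by rewrite assocV_pair assoc_pair.
Qed.

Lemma coalg_morphism_pair P Q (E : coalgData P) (F : coalgData Q) (a : Hom T P)
    (b : Hom T Q) : is_coalg_morphism D E a -> is_coalg_morphism D F b ->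
  is_coalg_morphism D (tens_coalg E F) ⟪a, b⟫.
Proof.
move=> [a0 a2] [b0 b2]; split; rewrite /= -comp_assoc tens_pair.
  by rewrite a0 b0 lunit_pair.
by rewrite a2 b2 -!pairE midbraid_pair.
Qed.

End Elements.

(** * Evaluation against the dual *)

Section Evaluation.
Variable C : strictBraidedCat.
Local Notation bw P Q := (w22 (@braid C P Q)).
Local Notation bwV P Q := (w22 (@braidV C P Q)).
Variables (X : C) (F : finite X).
Local Notation Y := (dual F).
Local Notation ev_w := (w20 (ev F)).
Local Notation coev_w := (w02 (coev F)).

Lemma zigzag_w Z : ev_w (X ⊗ Z) ∘ (X ◁ coev_w Z) = idm _.
Proof.
move: (zigzag_l F); move: (ev F) (coev F) => e a /(congr1 (fun k => k ▷ Z)).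
rewrite !whr_comp whr_whr whr_whl (whr20 e) (whr02 a).
idc_done.
Qed.

Lemma tilde_w (f : Hom X (Y ⊗ X)) Z :
  w21 (tilde f) Z = ev_w (X ⊗ Z) ∘ (X ◁ w12 f Z).
Proof.
rewrite w21E /tilde; move: (ev F) => e.
rewrite !whr_comp whr_whr whr_whl (whr20 e) (whr12 f).
idc_done.
Qed.

Lemma alpha_w (m : Hom (X ⊗ X) X) Z :
  w12 (alpha m F) Z
  = (Y ◁ w21 m Z) ∘ (bw X Y (X ⊗ Z) ∘ (X ◁ coev_w Z)).
Proof.
rewrite w12E /alpha; move: (coev F) => a.
rewrite !whr_comp !whr_whr !whr_whl (whr21 m) (whr02 a).
rewrite braid_whr; idc_done.
Qed.

Lemma conv_unit_w (D : coalgData X) Z :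
  w12 (conv_unit D F) Z = coev_w Z ∘ w10 (acounit D) Z.
Proof.
rewrite w12E /conv_unit; move: (coev F) => a.
rewrite (tensm_split (acounit D) a) !whr_comp whr_whr whr_whl.
rewrite (whr02 a) (whr10 (acounit D)).
have -> : w10 (acounit D) ((Y ⊗ X) ⊗ Z) = assocV Y X Z
    ∘ (w10 (acounit D) (Y ⊗ (X ⊗ Z)) ∘ (X ◁ assoc Y X Z)).
  rewrite -w10_nat; idc_done.
idc_unfold; idc_simp.
exact: esym (w10_nat _ _).
Qed.

Lemma conv_w (D : coalgData X) (f g : Hom X (Y ⊗ X)) Z :
  w12 (conv D f g) Z
  = (Y ◁ ev_w (X ⊗ Z)) ∘ (w12 f (Y ⊗ (X ⊗ Z))
    ∘ ((X ◁ w12 g Z) ∘ w12 (acomul D) Z)).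
Proof.
rewrite w12E /conv; move: (ev F) => e.
rewrite (tensm_split f g) !whr_comp !whr_whr !whr_whl (whr20 e).
rewrite (whr12 f) (whr12 g) (whr12 (acomul D)).
have -> : w12 f ((Y ⊗ X) ⊗ Z) = (Y ◁ (X ◁ assocV Y X Z))
    ∘ (w12 f (Y ⊗ (X ⊗ Z)) ∘ (X ◁ assoc Y X Z)).
  rewrite -w12_nat; idc_done.
idc_done.
Qed.

(* The braiding in alpha slides X past the dual; moved across the evaluation it
   becomes the inverse braiding of X with itself. *)
Lemma tilde_alpha (m : Hom (X ⊗ X) X) : tilde (alpha m F) = m ∘ @braidV C X X.
Proof.
apply: whr_inj => Z.
rewrite (whr_comp _ m) (whr21 (tilde _)) (whr21 m) braidV_whr tilde_w alpha_w.
have E : ev_w (X ⊗ (X ⊗ Z)) ∘ (X ◁ bw X Y (X ⊗ Z))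
    = (X ◁ ev_w (X ⊗ Z)) ∘ bwV X X (Y ⊗ (X ⊗ Z)).
  by rewrite bw_w20r; cn; crw (bwVK X X (Y ⊗ (X ⊗ Z))).
cn; crwV (w20_nat (ev F) (w21 m Z)).
crw E.
crwV (w22_nat (@braidV C X X) (coev_w Z)).
crw (whl2 X (zigzag_w Z)).
idc_done.
Qed.

(** Transposition along the evaluation turns convolution into successive action, [f] first, with the
    acting element duplicated by the coproduct. A convolution inverse therefore transposes to an
    inverse action. *)
Lemma tilde_conv (D : coalgData X) (f g : Hom X (Y ⊗ X)) :
  tilde (conv D f g)
  = tilde g ∘ (tilde f ▷ X) ∘ assocV X X X ∘ (X ◁ acomul D).
Proof.
have: forall Z, w21 (tilde (conv D f g)) Z
    = w21 (tilde g) Z ∘ (w21 (tilde f) (X ⊗ Z) ∘ (X ◁ w12 (acomul D) Z)).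
  move=> Z; rewrite !tilde_w conv_w; cn.
  crwV (w20_nat (ev F) (ev_w (X ⊗ Z))).
  crw (w20_nat (ev F) (X ◁ w12 g Z)).
  by crw (whl2 X (w12_nat f (w12 g Z))).
move: (tilde (conv D f g)) (tilde f) (tilde g) => r p q E; apply: whr_inj => Z.
rewrite !whr_comp whr_whr whr_whl (whr21 p) (whr21 q) (whr21 r) (whr12 (acomul D)).
rewrite E; idc_done.
Qed.

Lemma tilde_conv_unit (D : coalgData X) :
  tilde (conv_unit D F) = runit X ∘ (X ◁ acounit D).
Proof.
have: forall Z, w21 (tilde (conv_unit D F)) Z = X ◁ w10 (acounit D) Z.
  by move=> Z; rewrite tilde_w conv_unit_w; cn; crw (zigzag_w Z).
move: (tilde _) => r E; apply: whr_inj => Z.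
rewrite whr_comp whr_whl (whr21 r) (whr10 (acounit D)) E; idc_done.
Qed.

End Evaluation.

(** * The convolution group of generalized elements *)

Section Convolution.
Variable C : strictBraidedCat.
Variables (X : C) (H : hopfData X).
Hypotheses (hopfH : is_hopf H).
Variables (T : C) (D : coalgData T).
Hypotheses (coalgD : is_coalgebra D) (cocommD : cocommutative D).
Local Notation "⟪ f , g ⟫" := (pair D f g) (at level 0).
Local Notation "f ⋆ g" := (amul H ∘ ⟪f, g⟫) (at level 40, left associativity).
Local Notation one := (aunit H ∘ acounit D).
Local Notation elt := (is_coalg_morphism D H).

Lemma elt_comul f : elt f -> acomul H ∘ f = ⟪f, f⟫.
Proof. by rewrite pairE => -[]. Qed.

Lemma whr_comul_pair P f (g : Hom T P) : elt f ->
  (acomul H ▷ P) ∘ ⟪f, g⟫ = ⟪⟪f, f⟫, g⟫.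
Proof. by move=> Ef; rewrite whr_pair elt_comul. Qed.

Lemma convA f g h : f ⋆ (g ⋆ h) = (f ⋆ g) ⋆ h.
Proof.
have [[[_ E _] _ _ _] _ _] := hopfH.
by rewrite -whl_pair -assoc_pair // !comp_assoc E -comp_assoc whr_pair.
Qed.

Lemma conv1f f : one ⋆ f = f.
Proof.
have [[[E _ _] _ _ _] _ _] := hopfH.
by rewrite -whr_pair comp_assoc E lunit_pair.
Qed.

Lemma convf1 f : f ⋆ one = f.
Proof.
have [[[_ _ E] _ _ _] _ _] := hopfH.
by rewrite -whl_pair comp_assoc E runit_pair.
Qed.

Lemma convfV f : elt f -> f ⋆ (antipode H ∘ f) = one.
Proof.
have [_ E _] := hopfH.
move=> [f0 f2]; rewrite -whl_pair.
by rewrite pairE -f2 -f0 !comp_assoc E -!comp_assoc.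
Qed.

Lemma convVf f : elt f -> (antipode H ∘ f) ⋆ f = one.
Proof.
have [_ _ E] := hopfH.
move=> [f0 f2]; rewrite -whr_pair.
by rewrite pairE -f2 -f0 !comp_assoc E -!comp_assoc.
Qed.

Lemma mul_coalg_morphism : is_coalg_morphism (tens_coalg H H) H (amul H).
Proof.
have [[_ _ [_ E0] [_ E2]] _ _] := hopfH.
by split; [exact: E0 | rewrite E2 /= comp_assoc].
Qed.

Lemma elt_conv f g : elt f -> elt g -> elt (f ⋆ g).
Proof.
move=> Ef Eg; apply: coalg_morphism_comp mul_coalg_morphism _.
exact: coalg_morphism_pair.
Qed.

Lemma counit_pair : ⟪acounit D, acounit D⟫ = lunitV unitO ∘ acounit D.
Proof.
rewrite -{3}(lunit_pair coalgD (acounit D)); idc_unfold; by idc_simp.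
Qed.

Lemma comul_one : acomul H ∘ one = ⟪one, one⟫.
Proof.
have [[_ _ _ [E _]] _ _] := hopfH.
by rewrite -tens_pair counit_pair !comp_assoc E.
Qed.

Lemma elt_one : elt one.
Proof.
have [[_ _ [E _] _] _ _] := hopfH; split; last by rewrite comul_one pairE.
by rewrite comp_assoc E /= comp_idl.
Qed.

(* Left multiplication by f in the first, resp. second, tensor factor; having
   these act separately avoids the associativity of the algebra X ⊗ X. *)
Definition convl f (u : Hom T (X ⊗ X)) : Hom T (X ⊗ X) := w21 (amul H) X ∘ ⟪f, u⟫.
Definition convr f (u : Hom T (X ⊗ X)) : Hom T (X ⊗ X) :=
  (X ◁ amul H) ∘ (w22 (braid X X) X ∘ ⟪f, u⟫).

Lemma convl_pair f g h : convl f ⟪g, h⟫ = ⟪f ⋆ g, h⟫.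
Proof. by rewrite /convl w21E -comp_assoc assocV_pair // whr_pair. Qed.

Lemma convr_pair f g h : convr f ⟪g, h⟫ = ⟪g, f ⋆ h⟫.
Proof.
rewrite /convr w22E -!comp_assoc assocV_pair // whr_pair braid_pair //.
by rewrite assoc_pair // whl_pair.
Qed.

Lemma convlA f g u : convl f (convl g u) = convl (f ⋆ g) u.
Proof.
rewrite /convl -whl_pair comp_assoc -mulA_w // -comp_assoc.
by rewrite (w21E _ (X ⊗ X)) -(comp_assoc (_ ▷ _)) assocV_pair // whr_pair.
Qed.

Lemma convrA f g u : convr f (convr g u) = convr (f ⋆ g) u.
Proof.
have [[[_ A _] _ _ _] _ _] := hopfH.
have E : amul H ∘ (X ◁ amul H) = amul H ∘ w21 (amul H) X.
  rewrite w21E comp_assoc -A; idc_unfold; by idc_simp.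
rewrite /convr -!whl_pair; cn.
crwV (w22_nat (@braid C X X) (amul H)).
crw (whl2 X E).
crwV (bw_w21l X (amul H) X).
by rewrite w21E -!comp_assoc assocV_pair // whr_pair.
Qed.

Lemma convl1 u : convl one u = u.
Proof.
have E := mul1_w hopfH X; rewrite w01E in E.
rewrite /convl -whr_pair.
transitivity (w21 (amul H) X ∘ ((aunit H ▷ (X ⊗ X)) ∘ lunitV (X ⊗ X))
  ∘ (lunit _ ∘ ⟪acounit D, u⟫)).
  idc_done.
by rewrite E comp_idl lunit_pair.
Qed.

Lemma convr1 u : convr one u = u.
Proof.
have [[[E _ _] _ _ _] _ _] := hopfH.
rewrite /convr -whr_pair (chain2 (bw_natl X (aunit H) X)) bw_unitl; cn.
crw (whl2 X E).
by rewrite lunit_pair //; idc_unfold; idc_simp.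
Qed.

End Convolution.

(** * The antipode as a coalgebra morphism *)

Section Antipode.
Variable C : strictBraidedCat.
Variables (X : C) (H : hopfData X).
Hypotheses (hopfH : is_hopf H) (cocommH : cocommutative H).
Local Notation "⟪ f , g ⟫" := (pair H f g) (at level 0).

Lemma coalg_morphism_idm : is_coalg_morphism H H (idm X).
Proof. by split; rewrite ?tensm_id ?comp_idl comp_idr. Qed.

(** Puts the product of the algebra [X ⊗ X] in the shape of [convr] followed by [convl]. *)
Lemma mul_tens_alg : (amul H ⊠ amul H) ∘ midbraid X X X X
  = w21 (amul H) X ∘ ((X ◁ (X ◁ amul H)) ∘ ((X ◁ w22 (braid X X) X)
    ∘ assoc X X (X ⊗ X))).
Proof.
rewrite w21E w22E (tensm_split (amul H)) whl_tens /midbraid.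
rewrite (whr_whl X _ (braid X X)) !whl_comp -!comp_assoc.
idc_done.
Qed.

(** Uniqueness of inverses: δ ∘ λ and (λ ⊗ λ) ∘ δ are both convolution inverse to δ. *)
Lemma antipode_coalg_morphism : is_coalg_morphism H H (antipode H).
Proof.
have cH := hopf_coalgebra hopfH; have Ei := coalg_morphism_idm.
have V := convfV hopfH Ei; rewrite comp_idr in V.
have V' := convVf hopfH Ei; rewrite comp_idr in V'.
split.
  have [E0 _] := mul_coalg_morphism hopfH; have [E1 _] := elt_one hopfH cH.
  have := congr1 (fun k => acounit H ∘ k) V.
  by rewrite E1 comp_assoc E0 /= -comp_assoc tens_pair comp_idr lunit_pair.
rewrite -[RHS]pairE.
(* Multiplicativity of δ applied to [id ⋆ λ = one], with the left factor δ acting on the two tensor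
   factors separately. *)
have E : convl H H (idm X) (convr H H (idm X) (acomul H ∘ antipode H))
    = ⟪aunit H ∘ acounit H, aunit H ∘ acounit H⟫.
  have [[_ _ _ [_ E2]] _ _] := hopfH.
  rewrite -comul_one // -V comp_assoc E2 /= mul_tens_alg -!comp_assoc.
  rewrite tens_pair (elt_comul Ei).
  rewrite assoc_pair // /convl /convr.
  by rewrite !whl_pair.
(* Multiplying both factors of [E] by λ gives (λ ⊗ λ) ∘ δ from the right side and, after cancelling
   λ against the identity, δ ∘ λ from the left side. *)
transitivity (convr H H (antipode H) (convl H H (antipode H)
  ⟪aunit H ∘ acounit H, aunit H ∘ acounit H⟫)); last first.
  by rewrite convl_pair // convf1 // convr_pair // convf1.
by rewrite -E convlA // V' convl1 // convrA // V' convr1.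
Qed.

End Antipode.

(** * Post-Hopf algebras *)

Section PostHopfElements.
Variable C : strictBraidedCat.
Variables (X : C) (H : hopfData X) (F : finite X) (m : Hom (X ⊗ X) X).
Variable beta : Hom X (dual F ⊗ X).
Hypotheses (postH : is_post_hopf H F m) (cocommH : cocommutative H).
Hypothesis beta_inv : conv_inverse H (alpha m F) beta.
Hypothesis beta_comul : acomul H ∘ tilde beta
  = (tilde beta ⊠ tilde beta) ∘ midbraid X X X X ∘ (acomul H ⊠ acomul H).
Variables (T : C) (D : coalgData T).
Hypotheses (coalgD : is_coalgebra D) (cocommD : cocommutative D).
Local Notation "⟪ f , g ⟫" := (pair D f g) (at level 0).
Local Notation "f ⋆ g" := (amul H ∘ ⟪f, g⟫) (at level 40, left associativity).
Local Notation one := (aunit H ∘ acounit D).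
Local Notation elt := (is_coalg_morphism D H).
Local Notation act f g := (m ∘ ⟪f, g⟫).
Local Notation coact f g := (tilde beta ∘ ⟪g, f⟫).
Local Notation hat f g := (mul_hat H H m ∘ ⟪f, g⟫).
Let hopfH : is_hopf H := proj1 postH.

Lemma elt_act f g : elt f -> elt g -> elt (act f g).
Proof.
have [_ [Em _ _ _]] := postH => Ef Eg.
by apply: coalg_morphism_comp Em _; apply: coalg_morphism_pair.
Qed.

Lemma act_conv f g h : elt f -> act f (g ⋆ h) = act f g ⋆ act f h.
Proof.
have [_ [_ _ E _]] := postH => Ef.
rewrite -whl_pair comp_assoc E -comp_assoc whr_comul_pair //.
by rewrite -comp_assoc midbraid_pair // -comp_assoc tens_pair.
Qed.

Lemma hatE f g : elt f -> hat f g = f ⋆ act f g.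
Proof.
move=> Ef; rewrite /mul_hat -!comp_assoc whr_comul_pair //.
by rewrite assoc_pair // whl_pair.
Qed.

Lemma act_act f g h : act f (act g h) = act (hat f g) h.
Proof.
have [_ [_ E _ _]] := postH.
by rewrite -whl_pair -assoc_pair // !comp_assoc E -comp_assoc whr_pair.
Qed.

(** The inverse braiding of [tilde_alpha] merely swaps the two elements. *)
Lemma act_alpha f g : tilde (alpha m F) ∘ ⟪g, f⟫ = act f g.
Proof.
rewrite tilde_alpha -comp_assoc -(braid_pair cocommD f g).
by rewrite (comp_assoc (braidV _ _)) braidK comp_idl.
Qed.

(** The convolution identity is transposed by [tilde_conv] and evaluated at [⟪g, f⟫]. As [f] is a
    coalgebra morphism, both actions are by the same [f]. *)
Lemma tilde_inverse a b f g : conv H a b = conv_unit H F -> elt f ->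
  tilde b ∘ ⟪tilde a ∘ ⟪g, f⟫, f⟫ = g.
Proof.
move=> E Ef; have := congr1 (fun k => k ∘ ⟪g, f⟫) (tilde_conv H a b).
rewrite E tilde_conv_unit; move: (tilde a) (tilde b) => p q.
rewrite -!comp_assoc !whl_pair (elt_comul Ef) assocV_pair // whr_pair.
by rewrite (proj1 Ef) runit_pair.
Qed.

Lemma coactK f g : elt f -> coact f (act f g) = g.
Proof. by rewrite -act_alpha => Ef; apply: tilde_inverse => //; case: beta_inv. Qed.

Lemma actK f g : elt f -> act f (coact f g) = g.
Proof. by rewrite -act_alpha => Ef; apply: tilde_inverse => //; case: beta_inv. Qed.

Lemma counit_act f g : elt f -> acounit H ∘ act f g = acounit H ∘ g.
Proof.
have [_ [[E _] _ _ _]] := postH => Ef.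
by rewrite comp_assoc E /= -comp_assoc tens_pair (proj1 Ef) lunit_pair.
Qed.

(** The coproduct is preserved by [beta_comul]. The counit is preserved because [m] preserves it and
    [act f] sends [coact f g] to [g]. *)
Lemma elt_coact f g : elt f -> elt g -> elt (coact f g).
Proof.
move=> Ef Eg; split; first by rewrite -(counit_act _ Ef) actK // (proj1 Eg).
rewrite comp_assoc beta_comul -comp_assoc tens_pair (elt_comul Ef) (elt_comul Eg).
by rewrite -comp_assoc midbraid_pair // tens_pair pairE.
Qed.

(** An idempotent of the convolution group is neutral. *)
Lemma act_one f : elt f -> act f one = one.
Proof.
move=> Ef; set e := act f one.
have Ee : elt e by apply: elt_act => //; apply: elt_one.
have ee : e ⋆ e = e by rewrite -act_conv // convf1.
by rewrite -(convVf hopfH Ee) -{3}ee convA // convVf // conv1f.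
Qed.

(** Acting by [one] is idempotent, since [hat one one] is [one], and injective by [coactK]. *)
Lemma one_act g : act one g = g.
Proof.
have E1 := elt_one hopfH coalgD.
rewrite -[LHS](coactK _ E1) act_act hatE // act_one // convf1 //.
exact: coactK.
Qed.

Lemma one_hat g : hat one g = g.
Proof. by rewrite hatE ?one_act ?conv1f //; apply: elt_one. Qed.

Lemma hat_one f : elt f -> hat f one = f.
Proof. by move=> Ef; rewrite hatE // act_one // convf1. Qed.

Lemma elt_hat f g : elt f -> elt g -> elt (hat f g).
Proof. by move=> Ef Eg; rewrite hatE //; apply: elt_conv => //; apply: elt_act. Qed.

(** Both sides expand to the product of [f], [act f g] and [act f (act g h)], the last being the
    action of [hat f g] on [h]. *)
Lemma hatA f g h : elt f -> elt g -> elt h ->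
  hat f (hat g h) = hat (hat f g) h.
Proof.
move=> Ef Eg Eh; rewrite (hatE _ (elt_hat Ef Eg)) -act_act hatE // (hatE h Eg).
by rewrite act_conv // convA // -hatE.
Qed.

Lemma hat_coact_antipode f : elt f -> hat f (coact f (antipode H ∘ f)) = one.
Proof. by move=> Ef; rewrite hatE // actK // convfV. Qed.

Lemma elt_antipode f : elt f -> elt (antipode H ∘ f).
Proof. by apply: coalg_morphism_comp; apply: antipode_coalg_morphism. Qed.

(** Right inverses suffice in a monoid: [g] is a right inverse of [f] and [h] one of [g], so
    [f = hat f (hat g h) = h]. Forming [h] requires [g] to be an element again, hence [elt_coact]
    and [elt_antipode]. *)
Lemma coact_antipode_hat f : elt f -> hat (coact f (antipode H ∘ f)) f = one.
Proof.
move=> Ef; set g := coact f _.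
have Eg : elt g by apply: elt_coact => //; apply: elt_antipode.
set h := coact g (antipode H ∘ g).
have Eh : elt h by apply: elt_coact => //; apply: elt_antipode.
have gh : hat g h = one by apply: hat_coact_antipode.
have fg : hat f g = one by apply: hat_coact_antipode.
have fh : f = h by rewrite -[LHS](hat_one Ef) -gh hatA // fg one_hat.
by rewrite -[RHS]gh -fh.
Qed.

(** The factor [f] of [hat f g] cancels against its inverse, so Γ of the brace is the post-Hopf
    action. *)
Lemma brace_action_act f g : elt f ->
  brace_action H H (antipode H) (AlgData (aunit H) (mul_hat H H m)) ∘ ⟪f, g⟫
  = act f g.
Proof.
move=> Ef; rewrite /brace_action /= -!comp_assoc whr_comul_pair // assoc_pair //.
by rewrite tens_pair hatE // convA // convVf // conv1f.
Qed.

End PostHopfElements.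

(** * Testing morphisms on generalized elements *)

Section Extensionality.
Variable C : strictBraidedCat.
Local Notation bw P Q := (w22 (@braid C P Q)).
Variables (X : C) (H : hopfData X).
Hypotheses (hopfH : is_hopf H) (cocommH : cocommutative H).

(** By the hexagons the double crossing of [X] with [X ⊗ X] splits into two double crossings of [X]
    with itself. This gives cocommutativity of the threefold tensor coalgebra. *)
Lemma braid_tens_involutive : braid (X ⊗ X) X ∘ braid X (X ⊗ X) = idm _.
Proof.
have cc Z : bw X X Z ∘ bw X X Z = idm _.
  have := congr1 (fun k => assoc _ _ _ ∘ ((k ▷ Z) ∘ assocV _ _ _))
    (braid_involutive hopfH cocommH).
  by rewrite whr_comp !braid_whr; idc_unfold; idc_simp.
apply: whr_inj => Z; rewrite whr_comp !braid_whr bw_tensl bw_tensr.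
idc_unfold; idc_simp.
by crw (whl2 X (cc Z)); crw (cc (X ⊗ Z)); rewrite idc_comp idc_id.
Qed.

(** The universal test case is [T = X ⊗ X] with its two projections, whose pair is the identity. *)
Lemma hom2_ext P (f g : Hom (X ⊗ X) P) :
  (forall T (D : coalgData T) (a b : Hom T X),
    is_coalgebra D -> cocommutative D -> is_coalg_morphism D H a ->
    is_coalg_morphism D H b -> f ∘ pair D a b = g ∘ pair D a b) -> f = g.
Proof.
have cH := hopf_coalgebra hopfH.
move=> E; rewrite -(comp_idr f) -(comp_idr g) -(proj_pair cH cH) -!pairE.
apply: E; [exact: tens_coalg_coalgebra | | exact: tens_fst_coalg_morphism
  | exact: tens_snd_coalg_morphism].
by apply: tens_coalg_cocomm => //; apply: (braid_involutive hopfH).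
Qed.

Lemma hom3_ext P (f g : Hom (X ⊗ (X ⊗ X)) P) :
  (forall T (D : coalgData T) (a b c : Hom T X),
    is_coalgebra D -> cocommutative D -> is_coalg_morphism D H a ->
    is_coalg_morphism D H b -> is_coalg_morphism D H c ->
    f ∘ pair D a (pair D b c) = g ∘ pair D a (pair D b c)) -> f = g.
Proof.
have cH := hopf_coalgebra hopfH; have c2 := tens_coalg_coalgebra cH cH.
have s2 : cocommutative (tens_coalg H H).
  by apply: tens_coalg_cocomm => //; apply: (braid_involutive hopfH).
move=> E; rewrite -(comp_idr f) -(comp_idr g) -(proj_pair cH c2) -!pairE.
have: is_coalg_morphism (tens_coalg H (tens_coalg H H)) (tens_coalg H H)
    (tens_snd (X ⊗ X) (acounit H)) by exact: tens_snd_coalg_morphism.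
move: (tens_snd (X ⊗ X) _) => q q2.
(* The projection [q] onto the last two factors is a coalgebra morphism, so composing the generic
   pair of [X ⊗ X] with it splits [q] into its coordinates. *)
have -> : q = pair (tens_coalg H (tens_coalg H H))
    (tens_fst X (acounit H) ∘ q) (tens_snd X (acounit H) ∘ q).
  by rewrite -(pair_comp _ _ q2) proj_pair // comp_idl.
apply: E.
- exact: tens_coalg_coalgebra.
- by apply: tens_coalg_cocomm => //; apply: braid_tens_involutive.
- exact: tens_fst_coalg_morphism.
- by apply: coalg_morphism_comp q2; apply: tens_fst_coalg_morphism.
- by apply: coalg_morphism_comp q2; apply: tens_snd_coalg_morphism.
Qed.

End Extensionality.

(** * The Hopf brace assembled from identities between elements *)

Theorem theorem3p15 (C : strictBraidedCat) (X : C) (H : hopfData X)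
    (F : finite X) (m : Hom (X ⊗ X) X)
    (post_hopf : is_post_hopf H F m) (cocomm : cocommutative H)
    (beta : Hom X (dual F ⊗ X))
    (beta_inv : conv_inverse H (alpha m F) beta)
    (tilde_comul : acomul H ∘ tilde beta
      = (tilde beta ⊠ tilde beta) ∘ midbraid X X X X
        ∘ (acomul H ⊠ acomul H)) :
  is_cocommutative_hopf_brace H H (antipode H)
    (AlgData (aunit H) (mul_hat H H m)) (antipode_hat H (antipode H) beta).
Proof.
have hopfH := proj1 post_hopf; have cH := hopf_coalgebra hopfH.
have [[_ _ [e1 _] [d1 _]] _ _] := hopfH.
have Ei := coalg_morphism_idm H.
have dH : acomul H = pair H (idm X) (idm X) by rewrite pairE tensm_id comp_idl.
(* On the diagonal the braiding is a swap, so this is the inverse action of the identity element on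
   its convolution inverse. *)
have S : antipode_hat H (antipode H) beta = tilde beta ∘ pair H (antipode H) (idm X).
  rewrite /antipode_hat; move: (tilde beta) => b.
  by rewrite {1}dH -!comp_assoc whl_pair braid_pair // comp_idr.
have lV : lunitV X = pair H (acounit H) (idm X).
  by have [E _ _] := cH; rewrite pairE.
have rV : runitV X = pair H (idm X) (acounit H).
  by have [_ _ E] := cH; rewrite pairE.
(* This one statement yields the compatibility of the new product with both the counit and the
   coproduct. *)
have hat_morph : is_coalg_morphism (tens_coalg H H) H (mul_hat H H m).
  split; apply: (hom2_ext hopfH cocomm) => T D a b cD sD Ea Eb;
    have [E0 E2] := elt_hat post_hopf cD sD Ea Eb.
    by rewrite -comp_assoc E0 /= -comp_assoc tens_pair (proj1 Ea) (proj1 Eb) lunit_pair.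
  rewrite -comp_assoc E2 -pairE /= -(comp_assoc (_ ⊠ _)) -comp_assoc tens_pair.
  by rewrite (elt_comul Ea) (elt_comul Eb) midbraid_pair // tens_pair.
(* The antipode axioms are the two inverse laws taken at the identity of [X], viewed as an element
   over [H]. *)
have hV := hat_coact_antipode post_hopf beta_inv cH cocomm Ei.
have hV' := coact_antipode_hat post_hopf cocomm beta_inv tilde_comul cH cocomm Ei.
rewrite comp_idr -S in hV; rewrite comp_idr -S in hV'.
split=> //; split.
- exact: hopfH.
- split; last 2 first.
  + by rewrite /= -comp_assoc -pairE.
  + by rewrite /= -comp_assoc -pairE.
  split=> //.
  + split=> /=.
    * transitivity (mul_hat H H m ∘ ((aunit H ▷ X) ∘ lunitV X) ∘ lunit X).
        idc_done.
      by rewrite lV whr_pair (one_hat post_hopf beta_inv) // comp_idl.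
    * transitivity (mul_hat H H m ∘ (mul_hat H H m ▷ X) ∘ assocV X X X
        ∘ assoc X X X); last first.
        idc_done.
      congr (_ ∘ _); apply: (hom3_ext hopfH cocomm) => T D a b c cD sD Ea Eb Ec.
      rewrite -(comp_assoc _ (X ◁ _)) whl_pair -(comp_assoc _ (assocV _ _ _)).
      rewrite assocV_pair // -(comp_assoc _ (_ ▷ X)) whr_pair.
      exact: (hatA post_hopf).
    * transitivity (mul_hat H H m ∘ ((X ◁ aunit H) ∘ runitV X) ∘ runit X).
        idc_done.
      by rewrite rV whl_pair (hat_one post_hopf) // comp_idl.
  + by split=> //=; exact: (proj1 hat_morph).
  + by split=> //=; rewrite (proj2 hat_morph) /= comp_assoc.
(* On elements both sides of the brace identity are the product of [a], [act a b] and [act a c]. *)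
- apply: (hom3_ext hopfH cocomm) => T D a b c cD sD Ea Eb Ec /=.
  rewrite -comp_assoc whl_pair hatE // (act_conv post_hopf) //.
  rewrite -comp_assoc whr_comul_pair // -comp_assoc midbraid_pair //.
  rewrite -comp_assoc tens_pair (brace_action_act post_hopf) //.
  by rewrite hatE // convA.
Qed.
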